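(* Consider the system $x(s+1)=(1-a(s))x(s)+a(s)[P(s)x(s)+u(s)]$, $s=0,1,\ldots$, in $\mathbb{R}^n$. Suppose that either (A1), (A2) and (A3) hold with $\widetilde{\rho}_{\max}(P)=1$, or (A1), (A2') and (A3) hold with $\widetilde{\rho}_{\min}(P)=1$. Let $r$ be the algebraic multiplicity of the eigenvalue $1$ of $P$, and let $H\in\mathbb{C}^{n\times n}$ be an invertible matrix such that $P=H^{-1}DH$, where $D$ is the Jordan normal form of $P$ arranged as $$D=\begin{bmatrix} I_r & \mathbf{0}_{r\times(n-r)}\\ \mathbf{0}_{(n-r)\times r} & \underline{D}\end{bmatrix},\qquad \underline{D}\in\mathbb{C}^{(n-r)\times(n-r)}.$$ Then, for any initial state, $x(s)$ converges to $H^{-1}y$ in mean square, where $\bar{y}$ is a random vector satisfying $\mathbb{E}\bar{y}=\overline{Hx(0)}$ and $\mathbb{E}\|\bar{y}\|_2^2<\infty$, and $\underline{y}=(I_{n-r}-\underline{D})^{-1}\underline{Hu}$.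
   Context: Here $P(s)\in\mathbb{R}^{n\times n}$ and $u(s)\in\mathbb{R}^n$, $s\ge 0$, are random matrices and vectors on a common probability space, $a(s)\in\mathbb{R}$ is the gain, and $x(0)\in\mathbb{R}^n$ is the initial state. For $A\in\mathbb{R}^{n\times n}$ with eigenvalues $\lambda_i(A)$, $\widetilde{\rho}_{\max}(A):=\max_i \mathrm{Re}(\lambda_i(A))$ and $\widetilde{\rho}_{\min}(A):=\min_i\mathrm{Re}(\lambda_i(A))$. For $y\in\mathbb{C}^n$, $\bar{y}:=(y_1,\ldots,y_r)^\top$ and $\underline{y}:=(y_{r+1},\ldots,y_n)^\top$ (so $\overline{Hx(0)}$ is the vector of the first $r$ entries of $Hx(0)$ and $\underline{Hu}$ the vector of the last $n-r$ entries of $Hu$). (A1): there exist a matrix $P\in\mathbb{R}^{n\times n}$ and a vector $u\in\mathbb{R}^n$ such that $\mathbb{E}[P(s)\,|\,x(s)]=P$ and $\mathbb{E}[u(s)\,|\,x(s)]=u$ for any $s\ge 0$ and $x(s)\in\mathbb{R}^n$; also $\mathbb{E}[\|P(s)\|_2^2\,|\,x(s)]$ and $\mathbb{E}[\|u(s)\|_2^2\,|\,x(s)]$ are uniformly bounded. (A2): $\{a(s)\}$ are non-negative real numbers independent of $\{x(s)\}$ with $\sum_{s=0}^\infty a(s)=\infty$ and $\sum_{s=0}^\infty a^2(s)<\infty$. (A2'): $\{a(s)\}$ are non-positive real numbers independent of $\{x(s)\}$ with $\sum_{s=0}^\infty a(s)=-\infty$ and $\sum_{s=0}^\infty a^2(s)<\infty$.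 (A3): any eigenvalue of $P$ whose real part is $1$ equals $1$, the eigenvalue $1$ has the same algebraic and geometric multiplicities, and $\xi^T u=0$ for any left eigenvector $\xi^T$ of $P$ corresponding to the eigenvalue $1$. $x(s)$ converges to a random vector $x$ in mean square if $\mathbb{E}\|x\|_2^2<\infty$ and $\lim_{s\to\infty}\mathbb{E}\|x(s)-x\|_2^2=0$.
   Formalization: In (A1) the conditional means of P(s) and u(s) are taken given all observed states x(0),...,x(s), not given x(s) alone, since with x(s) alone time-correlated noise can keep x(s) from converging in mean square. *)

(* Defs.v *)
From HB Require Import structures.
From mathcomp Require Import all_boot all_order all_algebra.
From mathcomp Require Import complex.
From mathcomp Require Import all_classical all_reals all_analysis.

Set Implicit Arguments.
Unset Strict Implicit.
Unset Printing Implicit Defensive.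

Import Order.TTheory GRing.Theory Num.Theory.
Import numFieldNormedType.Exports.

Local Open Scope classical_set_scope.
Local Open Scope ring_scope.
Local Open Scope complex_scope.

Section LinearAlgebra.
Context {R : realType}.

Definition cplx_mx m n (A : 'M[R]_(m, n)) : 'M[R[i]]_(m, n) :=
  map_mx (real_complex R) A.

(* Eigenvalues repeated according to their algebraic multiplicity. *)
Definition eigenvalues n (A : 'M[R]_n) : seq R[i] :=
  sval (closed_field_poly_normal (char_poly (cplx_mx A))).

(* For 0 < n the list of eigenvalues is nonempty, so starting the iteration at
   its head yields the genuine maximum (resp. minimum). *)
Definition rho_max n (A : 'M[R]_n) : R :=
  \big[Num.max/complex.Re (head 0 (eigenvalues A))]_(l <- eigenvalues A)
    complex.Re l.

Definition rho_min n (A : 'M[R]_n) : R :=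
  \big[Num.min/complex.Re (head 0 (eigenvalues A))]_(l <- eigenvalues A)
    complex.Re l.

Definition alg_mult n (A : 'M[R[i]]_n) (l : R[i]) : nat :=
  mup l (char_poly A).

(* [eigenspace] consists of left eigenvectors; it has the same dimension as the
   space of right eigenvectors, both being n - \rank (A - l%:M). *)
Definition geo_mult n (A : 'M[R[i]]_n) (l : R[i]) : nat :=
  \rank (eigenspace A l).

Definition jordan_block k (l : R[i]) : 'M[R[i]]_k :=
  \matrix_(i, j) (l *+ (i == j) + (i.+1 == j :> nat)%:R).

Definition jordan_normal_form n (D : 'M[R[i]]_n) : Prop :=
  exists (q : nat) (k : 'I_q -> nat) (l : 'I_q -> R[i]) (e : \sum_i k i = n),
    (forall i, 0 < k i)%N /\
    D = castmx (e, e) (\mxdiag_(i < q) jordan_block (k i) (l i)).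

Definition norm2 n (v : 'cV[R]_n) : R := Num.sqrt (\sum_i (v i 0) ^+ 2).

Definition cnorm2 n (v : 'cV[R[i]]_n) : R :=
  Num.sqrt (\sum_i (ComplexField.Normc.normc (v i 0)) ^+ 2).

Definition mx_norm2 n (A : 'M[R]_n) : R :=
  sup [set norm2 (A *m v) | v in [set v : 'cV[R]_n | norm2 v <= 1]].

End LinearAlgebra.

Section Probability.
Context {d : measure_display} {T : measurableType d} {R : realType}.
Variable Pr : probability T R.

Definition random_mx m n (X : T -> 'M[R]_(m, n)) : Prop :=
  forall i j, measurable_fun [set: T] (fun w => X w i j).

Definition random_cvec n (X : T -> 'cV[R[i]]_n) : Prop :=
  forall i, measurable_fun [set: T] (fun w => complex.Re (X w i 0)) /\
            measurable_fun [set: T] (fun w => complex.Im (X w i 0)).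

(* Meaningful for integrable X, in particular when E||X||_2^2 is finite. *)
Definition expect_cvec n (X : T -> 'cV[R[i]]_n) : 'cV[R[i]]_n :=
  \col_i (fine 'E_Pr[fun w => complex.Re (X w i 0)]
            +i* fine 'E_Pr[fun w => complex.Im (X w i 0)]).

Definition sigma_vec n (X : T -> 'cV[R]_n) : set_system T :=
  g_sigma_preimage (fun i w => X w i 0).

Definition sigma_history n (x : nat -> T -> 'cV[R]_n) (s : nat) :
    set_system T :=
  <<s \bigcup_(k in `I_s.+1) sigma_vec (x k) >>.

(* g is a version of the conditional expectation E[f | G]. *)
Definition is_cond_expect (G : set_system T) (f g : T -> R) : Prop :=
  [/\ Pr.-integrable [set: T] (EFin \o f),
      Pr.-integrable [set: T] (EFin \o g),
      forall B : set R, measurable B -> G (g @^-1` B) &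
      forall A : set T, G A ->
        (\int[Pr]_(w in A) (f w)%:E = \int[Pr]_(w in A) (g w)%:E)%E ].

Definition cond_expect_bounded_by (G : set_system T) (f : T -> R) (C : R) :
    Prop :=
  exists2 g, is_cond_expect G f g & {ae Pr, forall w, g w <= C}.

Definition cvg_mean_square n (X : nat -> T -> 'cV[R[i]]_n)
    (L : T -> 'cV[R[i]]_n) : Prop :=
  [/\ random_cvec L,
      ('E_Pr[fun w => (cnorm2 (L w) ^+ 2)%R] < +oo)%E &
      ('E_Pr[fun w => (cnorm2 (X s w - L w) ^+ 2)%R] @[s --> \oo] --> 0)%E ].

(* The means are conditioned on the states observed up to time s.  Since then
   E[Ps s | x s] = P and E[us s | x s] = u as well, and conversely the two
   requirements agree when the noise depends on the past only through x s.
   Conditioning the means on x s alone, without such a Markov property, is not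
   enough for mean-square convergence: for n = 1, Ps s = 1 and us s = +1 or -1
   the increments can be correlated in time so that the state keeps travelling
   through an interval while E[us s | x s] = 0.  The second moments need only
   the conditioning on x s. *)
Definition A1 n (x : nat -> T -> 'cV[R]_n) (Ps : nat -> T -> 'M[R]_n)
    (us : nat -> T -> 'cV[R]_n) (P : 'M[R]_n) (u : 'cV[R]_n) : Prop :=
  [/\ forall s i j,
        is_cond_expect (sigma_history x s) (fun w => Ps s w i j)
          (cst (P i j)),
      forall s i,
        is_cond_expect (sigma_history x s) (fun w => us s w i 0)
          (cst (u i 0)),
      exists C : R, forall s,
        cond_expect_bounded_by (sigma_vec (x s))
          (fun w => mx_norm2 (Ps s w) ^+ 2) C &
      exists C : R, forall s,
        cond_expect_bounded_by (sigma_vec (x s))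
          (fun w => norm2 (us s w) ^+ 2) C ].

End Probability.

Section Gains.
Context {R : realType}.

Definition A2 (a : nat -> R) : Prop :=
  [/\ forall s, 0 <= a s,
      (\sum_(0 <= s <oo) (a s)%:E = +oo)%E &
      (\sum_(0 <= s <oo) (a s ^+ 2)%:E < +oo)%E ].

Definition A2' (a : nat -> R) : Prop :=
  [/\ forall s, a s <= 0,
      (\sum_(0 <= s <oo) (a s)%:E = -oo)%E &
      (\sum_(0 <= s <oo) (a s ^+ 2)%:E < +oo)%E ].

Definition A3 n (P : 'M[R]_n) (u : 'cV[R]_n) : Prop :=
  [/\ forall l : R[i],
        eigenvalue (cplx_mx P) l -> complex.Re l = 1 -> l = 1,
      alg_mult (cplx_mx P) 1 = geo_mult (cplx_mx P) 1 &
      forall xi : 'rV[R[i]]_n, xi != 0 ->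
        xi *m cplx_mx P = 1 *: xi -> xi *m cplx_mx u = 0 ].

End Gains.

(* Main.v *)
Require Import Defs.
From HB Require Import structures.
From mathcomp Require Import all_boot all_order all_algebra.
From mathcomp Require Import finmap complex.
From mathcomp Require Import all_classical all_reals all_analysis.
From mathcomp Require Import measurable_realfun ring lra.

(* With z = H x - (0, (I - Dl)^-1 (Hu)_low), the recursion splits the conditional
   drift from a noise term that is orthogonal, in L^2, to every affine function
   of the past states and whose second moment is at most K (1 + E|x|^2).  The
   last m coordinates satisfy z' = (I + a (Dl - I)) z + a noise with Dl upper
   triangular, and geometric weights on the coordinates give a quadratic form V
   with E V(z') <= (1 - beta |a|) E V(z) + K a^2 (1 + E|z|^2); by (A3), (Hu)_up
   vanishes and the first r coordinates are martingales with increments a noise.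
   As a^2 is summable, the total energy is bounded; then E V(z) tends to 0 since
   |a| is not summable, and the martingales are Cauchy, hence convergent, in L^2. *)

Set Implicit Arguments.
Unset Strict Implicit.
Unset Printing Implicit Defensive.

Import Order.TTheory GRing.Theory Num.Theory.
Import numFieldNormedType.Exports.

Local Open Scope classical_set_scope.
Local Open Scope ring_scope.
Local Open Scope complex_scope.

(** * Conditional expectations *)

(** Square integrability of the state is not given: the conditional bounds on the coefficients are
    first used as inequalities between possibly infinite integrals, and finiteness is read off from
    them. The noise in either block depends on the energy of both, so neither block can be treated
    alone. Boundedness of the total energy has to come before convergence of the contracting block,
    and among the properties of the gains it uses only the summability of a^2. On the last m
    coordinates the Euclidean norm need not decrease, since the superdiagonal ones of a Jordan block
    may outweigh the gap between 1 and the real part of the eigenvalue; hence the weights. Only real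
    parts matter because a^2 |(Dl - I) z|^2 is an error of the same order as the noise. Writing a =
    sg |a| and replacing Dl - I by sg (Dl - I) treats both signs of the gains at once. Conditioning
    the means on the whole history makes the martingale increments over disjoint time intervals
    orthogonal. *)

Section ConditionalExpectation.
Context d (T : measurableType d) (R : realType) (Pr : probability T R).
Variable U : set_system T.
Hypothesis mU : <<s U >> `<=` measurable.

Local Notation L1 f := (Pr.-integrable [set: T] (EFin \o f)).

Lemma measurable_sigmaW (Z : T -> R) :
  measurable_fun setT (Z : g_sigma_algebraType U -> R) -> measurable_fun setT Z.
Proof. by move=> mZ _ B mB; apply: mU; exact: (mZ measurableT B mB). Qed.

Import HBNNSimple.

(** Reduces a simple weight to its level sets, which are the sets on which a conditional hypothesis
    can be tested. *)
Let integral_mul_nnsfun (f : T -> R) (h : {nnsfun (g_sigma_algebraType U) >-> R})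
    (s := fset_set (h @` setT)) :
  measurable_fun setT f -> (forall w, 0 <= f w) ->
  (\int[Pr]_w (f w * h w)%:E = \sum_(i < #|` s|)
     ((s`_i)%:E * \int[Pr]_(w in h @^-1` [set s`_i]) (f w)%:E))%E.
Proof.
move=> mf f0.
have mh i : measurable (h @^-1` [set s`_i] : set T).
  by apply: mU; exact: (@measurable_funPTI _ _ (g_sigma_algebraType U)).
have s0 (i : 'I_(#|` s|)) : 0 <= s`_i.
  have : s`_i \in s by apply: mem_nth.
  by rewrite in_fset_set; [move/set_mem => [w _ <-]|exact: fimfunP].
transitivity (\int[Pr]_w \sum_(i < #|` s|)
    ((s`_i)%:E * (f w * \1_(h @^-1` [set s`_i]) w)%:E))%E.
  apply: eq_integral => w _.
  rewrite fimfunEord mulr_sumr -sumEFin; apply: eq_bigr => i _.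
  by rewrite -EFinM mulrCA.
rewrite ge0_integral_sum//; last 2 first.
- move=> i; apply: measurable_funeM; apply/measurable_EFinP.
  apply: measurable_funM => //; exact: measurable_indic.
- by move=> i w _; rewrite mule_ge0 ?lee_fin ?s0// mulr_ge0.
apply: eq_bigr => i _; rewrite ge0_integralZl//; last 3 first.
- apply/measurable_EFinP; apply: measurable_funM => //; exact: measurable_indic.
- by move=> w _; rewrite lee_fin mulr_ge0.
- by rewrite lee_fin s0.
congr (_ * _)%E; rewrite [RHS]integral_mkcond; apply: eq_integral => w _.
by rewrite epatch_indic.
Qed.

(** Simple weights are handled level set by level set, general ones by monotone convergence. Both
    sides may be infinite, so the inequality is available before the products are known to be
    integrable. *)
Lemma cond_le_integral_mul (f g Z : T -> R) :
  measurable_fun setT f -> (forall w, 0 <= f w) ->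
  measurable_fun setT g -> (forall w, 0 <= g w) ->
  (forall A, <<s U >> A ->
    \int[Pr]_(w in A) (f w)%:E <= \int[Pr]_(w in A) (g w)%:E)%E ->
  measurable_fun setT (Z : g_sigma_algebraType U -> R) ->
  (forall w, 0 <= Z w) ->
  (\int[Pr]_w (f w * Z w)%:E <= \int[Pr]_w (g w * Z w)%:E)%E.
Proof.
move=> mf f0 mg g0 fg mZ Z0.
have mZE : measurable_fun setT (EFin \o Z : g_sigma_algebraType U -> \bar R).
  exact/measurable_EFinP.
pose h := nnsfun_approx measurableT mZE.
have mh n : measurable_fun setT (h n : T -> R).
  by apply: measurable_sigmaW.
have cvgh w : h n w @[n --> \oo] --> Z w.
  have /fine_cvgP[] := cvg_nnsfun_approx measurableT mZE (fun w _ => Z0 w) (I : setT w).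
  by [].
have mct (k : T -> R) : measurable_fun setT k -> (forall w, 0 <= k w) ->
    (\int[Pr]_w (k w * h n w)%:E @[n --> \oo] --> \int[Pr]_w (k w * Z w)%:E)%E.
  move=> mk k0.
  have -> : (\int[Pr]_w (k w * Z w)%:E =
             \int[Pr]_w limn (fun n => (k w * h n w)%:E))%E.
    apply: eq_integral => w _; apply/esym/cvg_lim => //.
    by apply: cvg_EFin; [exact: nearW|apply: cvgM; [exact: cvg_cst|exact: cvgh]].
  apply: cvg_monotone_convergence => //.
  - by move=> n; apply/measurable_EFinP; exact: measurable_funM.
  - by move=> n w _; rewrite lee_fin mulr_ge0.
  - move=> w _ m n mn; rewrite lee_fin ler_wpM2l//.
    exact: (lefP _ _ (nd_nnsfun_approx measurableT mZE mn)).
apply: lee_cvg_to (mct _ mf f0) (mct _ mg g0) _.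
apply: nearW => n; rewrite !integral_mul_nnsfun//; apply: lee_sum => i _.
apply: lee_pmul => //.
- rewrite lee_fin.
  have : (fset_set (h n @` setT))`_i \in fset_set (h n @` setT) by apply: mem_nth.
  by rewrite in_fset_set; [move/set_mem => [w _ <-]|exact: fimfunP].
- by apply: integral_ge0 => w _; rewrite lee_fin.
- by apply: fg; exact: (@measurable_funPTI _ _ (g_sigma_algebraType U)).
Qed.

(** The constant is [Num.max C 0] because the comparison of weighted integrals wants a nonnegative
    dominating function. *)
Lemma cond_bounded_integral_mul (f Z : T -> R) (C : R) :
  (forall w, 0 <= f w) -> cond_expect_bounded_by Pr <<s U >> f C ->
  measurable_fun setT (Z : g_sigma_algebraType U -> R) -> (forall w, 0 <= Z w) ->
  (\int[Pr]_w (f w * Z w)%:E <= \int[Pr]_w (Num.max C 0 * Z w)%:E)%E.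
Proof.
move=> f0 [g [if_ ig _ fg] gC] mZ Z0.
have mf : measurable_fun setT f by apply/measurable_EFinP; case/integrableP : if_.
apply: cond_le_integral_mul => //.
  by move=> w; rewrite le_max lexx orbT.
move=> A sA; rewrite fg//.
have mA : measurable A by exact: mU.
have igA : Pr.-integrable A (EFin \o g) by exact: integrableS ig.
(* The version [g] may take negative values; its positive part fits the almost everywhere comparison
   of nonnegative functions. *)
apply: (@le_trans _ _ (\int[Pr]_(w in A) (EFin \o g)^\+ w)%E).
  apply: le_integral => //; first exact: integrable_funepos.
  by move=> w _; rewrite funeposE le_max lexx.
apply: ae_ge0_le_integral => //.
- exact: (measurable_int Pr (integrable_funepos mA igA)).
- by move=> w _; rewrite lee_fin le_max lexx orbT.
apply: filterS gC => w gC _.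
by rewrite funeposE /= -EFin_max lee_fin ge_max !le_max gC lexx orbT.
Qed.

(** The positive and negative parts of [h] have equal integrals on every set of the
    sub-sigma-algebra, so the comparison of weighted integrals, applied in both directions, makes
    their weighted integrals equal. *)
Let cond_centered_mul_ge0 (h Z : T -> R) : L1 h ->
  (forall A, <<s U >> A -> (\int[Pr]_(w in A) (h w)%:E = 0)%E) ->
  measurable_fun setT (Z : g_sigma_algebraType U -> R) -> (forall w, 0 <= Z w) ->
  L1 (fun w => h w * Z w) -> \int[Pr]_w (h w * Z w) = 0.
Proof.
move=> ih h0 mZ Z0 ihZ.
have mh : measurable_fun setT h by apply/measurable_EFinP; case/integrableP : ih.
have mZT := measurable_sigmaW mZ.
have mpos (k : T -> R) : measurable_fun setT k ->
    measurable_fun setT (fun w => Num.max (k w) 0).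
  by move=> mk; apply: measurable_maxr.
have ipos (k : T -> R) : L1 k -> L1 (fun w => Num.max (k w) 0).
  move=> ik; have mk : measurable_fun setT k.
    by apply/measurable_EFinP; case/integrableP : ik.
  apply: le_integrable ik => //; first exact/measurable_EFinP/mpos.
  move=> w _ /=; rewrite lee_fin [leLHS]ger0_norm ?le_max ?lexx ?orbT//.
  by rewrite ge_max ler_norm normr_ge0.
have iN (k : T -> R) : L1 k -> L1 (fun w => - k w).
  by move=> ik; apply: eq_integrable (integrableN ik).
pose hp w := Num.max (h w) 0; pose hn w := Num.max (- h w) 0.
have hE w : h w = hp w - hn w.
  by rewrite /hp /hn; case: (leP (h w) 0) => h1; case: (leP (- h w) 0) => h2; lra.
have hp0 w : 0 <= hp w by rewrite le_max lexx orbT.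
have hn0 w : 0 <= hn w by rewrite le_max lexx orbT.
have ihp : L1 hp by exact: ipos.
have ihn : L1 hn by apply: (ipos (fun w => - h w)); exact: iN.
have mhp : measurable_fun setT hp by exact: mpos.
have mhn : measurable_fun setT hn.
  by apply: (mpos (fun w => - h w)); exact: measurableT_comp.
have hpn A : <<s U >> A ->
    (\int[Pr]_(w in A) (hp w)%:E = \int[Pr]_(w in A) (hn w)%:E)%E.
  move=> sA; have mA := mU sA.
  rewrite (eq_integral (fun w => (hn w)%:E + (h w)%:E)%E); last first.
    by move=> w _; rewrite -EFinD hE; congr EFin; lra.
  rewrite integralD//; [|exact: integrableS ihn|exact: integrableS ih].
  by rewrite h0// adde0.
have ipZ : L1 (fun w => hp w * Z w).
  apply: le_integrable ihZ => //.
    by apply/measurable_EFinP; exact: measurable_funM.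
  move=> w _ /=; rewrite lee_fin !normrM ler_wpM2r// (ger0_norm (hp0 w)).
  by rewrite /hp ge_max ler_norm normr_ge0.
have inZ : L1 (fun w => hn w * Z w).
  apply: le_integrable ihZ => //.
    by apply/measurable_EFinP; exact: measurable_funM.
  move=> w _ /=; rewrite lee_fin !normrM ler_wpM2r// (ger0_norm (hn0 w)).
  by rewrite /hn ge_max -normrN ler_norm normr_ge0.
rewrite (eq_Rintegral Pr (g := fun w => hp w * Z w - hn w * Z w)); last first.
  by move=> w _; rewrite -mulrBl -hE.
rewrite RintegralB//; apply/eqP; rewrite subr_eq0; apply/eqP; congr fine.
by apply/eqP; rewrite eq_le !cond_le_integral_mul// => A sA; rewrite hpn.
Qed.

(** Now the weight is split into its positive and negative parts; each product with [h] is dominated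
    by |h Z|, hence integrable. *)
Lemma cond_centered_mul (h Z : T -> R) : L1 h ->
  (forall A, <<s U >> A -> (\int[Pr]_(w in A) (h w)%:E = 0)%E) ->
  measurable_fun setT (Z : g_sigma_algebraType U -> R) ->
  L1 (fun w => h w * Z w) -> \int[Pr]_w (h w * Z w) = 0.
Proof.
move=> ih h0 mZ ihZ.
have mh : measurable_fun setT h by apply/measurable_EFinP; case/integrableP : ih.
have mpos (k : T -> R) : measurable_fun setT (k : g_sigma_algebraType U -> R) ->
    measurable_fun setT ((fun w => Num.max (k w) 0) : g_sigma_algebraType U -> R).
  by move=> mk; apply: measurable_maxr.
pose Zp w := Num.max (Z w) 0; pose Zn w := Num.max (- Z w) 0.
have mZp : measurable_fun setT (Zp : g_sigma_algebraType U -> R) by exact: mpos.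
have mZn : measurable_fun setT (Zn : g_sigma_algebraType U -> R).
  by apply: (mpos (fun w => - Z w)); exact: measurableT_comp.
have Zp0 w : 0 <= Zp w by rewrite le_max lexx orbT.
have Zn0 w : 0 <= Zn w by rewrite le_max lexx orbT.
have ip : L1 (fun w => h w * Zp w).
  apply: le_integrable ihZ => //.
    by apply/measurable_EFinP; apply: measurable_funM => //; exact: measurable_sigmaW.
  move=> w _ /=; rewrite lee_fin !normrM ler_wpM2l// (ger0_norm (Zp0 w)).
  by rewrite /Zp ge_max ler_norm normr_ge0.
have in_ : L1 (fun w => h w * Zn w).
  apply: le_integrable ihZ => //.
    by apply/measurable_EFinP; apply: measurable_funM => //; exact: measurable_sigmaW.
  move=> w _ /=; rewrite lee_fin !normrM ler_wpM2l// (ger0_norm (Zn0 w)).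
  by rewrite /Zn ge_max -normrN ler_norm normr_ge0.
rewrite (eq_Rintegral Pr (g := fun w => h w * Zp w - h w * Zn w)); last first.
  move=> w _; rewrite -mulrBr; congr (_ * _); rewrite /Zp /Zn.
  by case: (leP (Z w) 0) => h1; case: (leP (- Z w) 0) => h2; lra.
by rewrite RintegralB// !cond_centered_mul_ge0// subr0.
Qed.

Lemma cond_expect_cst_centered (f : T -> R) (c : R) :
  is_cond_expect Pr <<s U >> f (cst c) ->
  L1 (fun w => f w - c) /\
  forall A, <<s U >> A -> (\int[Pr]_(w in A) (f w - c)%:E = 0)%E.
Proof.
move=> [if_ ic _ fc]; split.
  exact: eq_integrable (integrableB measurableT if_ ic).
move=> A sA; have mA := mU sA.
have ifA : Pr.-integrable A (EFin \o f) by exact: integrableS if_.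
have icA : Pr.-integrable A (EFin \o cst c) by exact: integrableS ic.
under eq_integral do rewrite EFinB.
by rewrite integralB// fc// subee// integrable_fin_num.
Qed.

End ConditionalExpectation.

(** * Square-integrable functions *)

Section SquareIntegrable.
Context d (T : measurableType d) (R : realType) (Pr : probability T R).
Implicit Types f g : T -> R.

Local Notation L1 f := (Pr.-integrable [set: T] (EFin \o f)).
Local Notation L2 f := (f \in Lfun Pr 2%:E).

Lemma Lfun2_measurable f : L2 f -> measurable_fun setT f.
Proof. by rewrite inE => /andP[/[!inE]]. Qed.

Lemma sqr_integrable_Lfun2 f : measurable_fun setT f ->
  L1 (fun w => f w ^+ 2) -> L2 f.
Proof.
move=> mf /integrableP[_ if2]; rewrite inE; apply/andP; split; rewrite inE//=.
rewrite /finite_norm unlock /Lnorm poweR_lty//.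
rewrite (le_lt_trans _ if2)//; apply: ge0_le_integral => //.
- by move=> w _; exact: poweR_ge0.
- apply: (@measurableT_comp _ _ _ _ _ _ (@poweR R ^~ 2)).
    exact: measurable_poweR.
  by apply: measurableT_comp => //; exact/measurable_EFinP.
- apply/measurable_EFinP; apply: measurableT_comp => //.
  exact: measurable_funX.
- by move=> w _ /=; rewrite lee_fin powR_mulrn// normrX.
Qed.

Lemma Lfun2D f g : L2 f -> L2 g -> L2 (fun w => f w + g w).
Proof. exact: (Lfun_addr_closed Pr (lee1n 2)).2. Qed.

Lemma Lfun2Z f c : L2 f -> L2 (fun w => c * f w).
Proof. by move=> lf; rewrite (_ : (fun _ => _) = c \o* f) ?Lfun_scale ?ler1n//; apply/funext => w /=; rewrite mulrC. Qed.

Lemma Lfun2_cst (c : R) : L2 (fun=> c).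
Proof. exact: (Lfun_cst Pr c 2). Qed.

Lemma Lfun2B f g : L2 f -> L2 g -> L2 (fun w => f w - g w).
Proof. by move=> lf lg; apply: Lfun2D => //; exact: Lfun_oppr_closed. Qed.

Lemma Lfun2_sum (I : Type) (r : seq I) (F : I -> T -> R) :
  (forall i, L2 (F i)) -> L2 (fun w => \sum_(i <- r) F i w).
Proof.
move=> lF; elim: r => [|i r IH].
  by under eq_fun do rewrite big_nil; exact: Lfun2_cst.
by under eq_fun do rewrite big_cons; exact: Lfun2D.
Qed.

Lemma Lfun2M_integrable f g : L2 f -> L2 g -> L1 (fun w => f w * g w).
Proof. by move=> lf lg; apply/Lfun1_integrable/Lfun2_mul_Lfun1. Qed.

Lemma Lfun2X_integrable f : L2 f -> L1 (fun w => f w ^+ 2).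
Proof. exact: Lfun2_integrable_sqr. Qed.

Lemma Lfun2_integrable f : L2 f -> L1 f.
Proof.
by move=> lf; apply/Lfun1_integrable; apply: Lfun_subset12 lf; rewrite fin_num_measure.
Qed.

Lemma integrableD_EFin f g : L1 f -> L1 g -> L1 (fun w => f w + g w).
Proof. by move=> lf lg; apply: eq_integrable (integrableD _ lf lg). Qed.

Lemma integrableZ_EFin f c : L1 f -> L1 (fun w => c * f w).
Proof. by move=> lf; apply: eq_integrable (integrableZl _ c lf). Qed.

Lemma integrable_sum_EFin (I : Type) (r : seq I) (F : I -> T -> R) :
  (forall i, L1 (F i)) -> L1 (fun w => \sum_(i <- r) F i w).
Proof.
move=> lF; elim: r => [|i r IH].
  by under eq_fun do rewrite big_nil; apply/Lfun2_integrable/Lfun2_cst.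
by under eq_fun do rewrite big_cons; exact: integrableD_EFin.
Qed.

Lemma Rintegral_sum (I : Type) (r : seq I) (F : I -> T -> R) :
  (forall i, L1 (F i)) ->
  \int[Pr]_w (\sum_(i <- r) F i w) = \sum_(i <- r) \int[Pr]_w F i w.
Proof.
move=> lF; elim: r => [|i r IH].
  rewrite big_nil; under eq_Rintegral do rewrite big_nil.
  by rewrite Rintegral_cst// mul0r.
rewrite big_cons -IH -RintegralD//; last exact: integrable_sum_EFin.
by apply: eq_Rintegral => w _; rewrite big_cons.
Qed.

Lemma EFin_Rintegral f : L1 f ->
  (\int[Pr]_w f w)%:E = (\int[Pr]_w (f w)%:E)%E.
Proof. by move=> lf; rewrite fineK// integrable_fin_num. Qed.

Lemma Rintegral_cst_probability (c : R) : \int[Pr]_w c = c.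
Proof. by rewrite Rintegral_cst// [X in fine X]probability_setT mulr1. Qed.

(** Nonnegativity of the variance, by expanding the square of f - E f. *)
Lemma Rintegral_sqr_le f : L2 f -> (\int[Pr]_w f w) ^+ 2 <= \int[Pr]_w (f w ^+ 2).
Proof.
move=> lf; set m := \int[Pr]_w f w.
have := Rintegral_ge0 Pr (D := setT) (f := fun w => (f w - m) ^+ 2)
  (fun w _ => sqr_ge0 _).
rewrite (eq_Rintegral Pr (g := fun w => f w ^+ 2 + (- (2 * m)) * f w + m ^+ 2)); last first.
  by move=> w _; ring.
have lf1 := Lfun2_integrable lf; have lf2 := Lfun2X_integrable lf.
have lz : L1 (fun w => - (2 * m) * f w) by exact: integrableZ_EFin.
rewrite RintegralD//; [|exact: integrableD_EFin|exact/Lfun2_integrable/Lfun2_cst].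
rewrite RintegralD// RintegralZl// Rintegral_cst_probability -/m; lra.
Qed.

End SquareIntegrable.

(* A subsequence whose increments have second moments at most 4^-k converges
   almost surely, and Fatou's lemma identifies its limit as the L^2 limit. *)
Section L2Completeness.
Context d (T : measurableType d) (R : realType) (Pr : probability T R).

(** With p = 2^k one has |D_k| <= 1/p + p D_k^2, so a geometric series plus the assumed one
    dominates. The weight 2^k is small enough to remain summable against second moments of size
    4^-k. *)
Let cvg_series_of_weighted_sqr (D : nat -> R) :
  (\sum_(k <oo) (2 ^+ k * D k ^+ 2)%:E < +oo)%E -> cvgn (series D).
Proof.
move=> fin; apply: normed_cvg.
have cvg2 : cvgn (series (fun k => 2 ^+ k * D k ^+ 2)).
  apply: nnseries_is_cvg => //.
  by move=> k; rewrite mulr_ge0 ?sqr_ge0 ?exprn_ge0.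
have cvg1 : cvgn (series (geometric 1 (2^-1 : R))).
  by apply: is_cvg_geometric_series; rewrite ger0_norm ?invf_lt1 ?ltr1n.
apply: (@series_le_cvg _ _ (fun k => 1 * 2^-1 ^+ k + 2 ^+ k * D k ^+ 2))
  (is_cvg_seriesD cvg1 cvg2) => [k|k|k] /=.
- by rewrite normr_ge0.
- by rewrite mul1r addr_ge0 // mulr_ge0 // sqr_ge0.
rewrite mul1r exprVn -(ger0_norm (sqr_ge0 (D k))) normrX.
have p0 : 0 < 2 ^+ k :> R by rewrite exprn_gt0.
set p := 2 ^+ k in p0 *; set t := `|D k|.
have t0 : 0 <= t by exact: normr_ge0.
have -> : p^-1 + p * t ^+ 2 = t + (p^-1 + p * t ^+ 2 - t) by ring.
rewrite lerDl.
have -> : p^-1 + p * t ^+ 2 - t = p^-1 * ((p * t - 1) ^+ 2 + p * t).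
  by field; rewrite gt_eqF.
by rewrite mulr_ge0 ?invr_ge0 ?addr_ge0 ?sqr_ge0 ?mulr_ge0// ltW.
Qed.

Let limn_einf_le (u : nat -> \bar R) (e : \bar R) :
  (forall k, (u k <= e)%E) -> (limn_einf u <= e)%E.
Proof.
move=> ue; rewrite limn_einf_lim; apply: lime_le; first exact: is_cvg_einfs.
apply: nearW => n; apply: le_trans (ue n).
by apply: ereal_inf_lbound; exists n => //=.
Qed.

Lemma Lfun2_complete (X : nat -> T -> R) :
  (forall s, X s \in Lfun Pr 2%:E) ->
  (forall e : R, 0 < e -> exists N, forall s t, (N <= s)%N -> (N <= t)%N ->
     \int[Pr]_w ((X t w - X s w) ^+ 2) <= e) ->
  exists2 L, L \in Lfun Pr 2%:E &
    forall e : R, 0 < e -> exists N, forall s, (N <= s)%N ->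
      \int[Pr]_w ((X s w - L w) ^+ 2) <= e.
Proof.
move=> X2 cauchy.
have XB s t : X t \- X s \in Lfun Pr 2%:E by exact: Lfun2B.
have mX s := Lfun2_measurable (X2 s).
have /choice[phi phiP] (k : nat) : exists N, (k <= N)%N /\
    forall s t, (N <= s)%N -> (N <= t)%N ->
     \int[Pr]_w ((X t w - X s w) ^+ 2) <= (4^-1) ^+ k.
  have [|N NP] := cauchy ((4^-1) ^+ k); first by rewrite exprn_gt0.
  exists (maxn N k); rewrite leq_maxr; split => // s t.
  by rewrite !geq_max => /andP[? _] /andP[? _]; exact: NP.
(* Partial sums of [phi] give nondecreasing indices that still dominate both [phi k] and k. *)
pose n_ k := (\sum_(j < k.+1) phi j)%N.
have n_S k : (n_ k <= n_ k.+1)%N by rewrite /n_ [leqRHS]big_ord_recr leq_addr.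
have phi_n k : (phi k <= n_ k)%N by rewrite /n_ big_ord_recr /= leq_addl.
have n_ge k : (k <= n_ k)%N by rewrite (leq_trans _ (phi_n k))// (phiP k).1.
pose Y k := X (n_ k).
pose D k w := Y k.+1 w - Y k w.
have mD k : measurable_fun setT (D k) by exact: measurable_funB (mX _) (mX _).
have intD k : \int[Pr]_w (D k w ^+ 2) <= (4^-1) ^+ k.
  by apply: (phiP k).2 => //; exact: leq_trans (n_S k).
pose f k w := (2 ^+ k * D k w ^+ 2)%:E.
have f0 k w : (0 <= f k w)%E.
  by rewrite lee_fin mulr_ge0 ?sqr_ge0 ?exprn_ge0.
have mf k : measurable_fun setT (f k).
  by apply/measurable_EFinP; apply: measurable_funM => //; exact: measurable_funX.
have fin : (\int[Pr]_w \sum_(k <oo) f k w < +oo)%E.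
  rewrite integral_nneseries//.
  (* The bound 2^k 4^-k = 2^-k is written as 2 / 2^(k+1), the form of this geometric series. *)
  have cvg2 := @cvg_geometric_eseries_half R 2 0.
  apply: (@le_lt_trans _ _ (\sum_(k <oo) (2 / (2 ^ (k + 1))%:R)%:E)%E); last first.
    by have /cvg_lim -> := cvg2; rewrite ?ltry.
  apply: lee_nneseries => [k _ _|k _]; first exact: integral_ge0.
  have iD2 : Pr.-integrable setT (EFin \o (fun w => D k w ^+ 2)).
    exact/Lfun2X_integrable/XB.
  rewrite /f -EFin_Rintegral; last exact: integrableZ_EFin.
  rewrite RintegralZl// lee_fin.
  apply: (@le_trans _ _ (2 ^+ k * (4^-1) ^+ k)); first by rewrite ler_wpM2l ?exprn_ge0.
  rewrite -exprMn natrX exprD expr1 invfM mulrCA divff// mulr1 -exprVn.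
  by rewrite (_ : 2 * 4^-1 = 2^-1)//; field.
have finae : {ae Pr, forall w, (\sum_(k <oo) f k w < +oo)%E}.
  have : Pr.-integrable setT (fun w => \sum_(k <oo) f k w)%E.
    apply/integrableP; split; first exact: ge0_emeasurable_sum.
    apply: le_lt_trans fin; rewrite le_eqVlt; apply/orP; left; apply/eqP/eq_integral => w _.
    by rewrite gee0_abs// nneseries_ge0.
  move/(integrable_ae measurableT); apply: filterS => w /(_ I).
  by rewrite fin_numElt => /andP[].
(* The upper limit makes [L] defined and measurable everywhere, with value 0 where it is infinite;
   almost surely it is the true limit. *)
pose L w := fine (limn_esup (fun k => (Y k w)%:E)).
have mL : measurable_fun setT L.
  apply: measurableT_comp => //; apply: measurable_fun_limn_esup => k.
  exact/measurable_EFinP/mX.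
have cvgL : {ae Pr, forall w, Y k w @[k --> \oo] --> L w}.
  apply: filterS finae => w /cvg_series_of_weighted_sqr cs.
  have : cvgn (fun k => Y k w).
    rewrite (_ : (fun k => Y k w) = fun k => Y 0%N w + series (D^~ w) k).
      by apply: is_cvgD => //; exact: is_cvg_cst.
    apply/funext => k; rewrite (eq_sum_telescope (fun k => Y k w) k).
    by [].
  move=> /cvg_ex[l Yl]; suff -> : L w = l by [].
  have lim : (Y k w)%:E @[k --> \oo] --> l%:E.
    by apply: cvg_EFin => //; exact: nearW.
  by rewrite /L (cvg_limn_einf_sup lim).2.
have key e N : (forall s t, (N <= s)%N -> (N <= t)%N ->
     \int[Pr]_w ((X t w - X s w) ^+ 2) <= e) -> forall s, (N <= s)%N ->
   (\int[Pr]_w ((X s w - L w) ^+ 2)%:E <= e%:E)%E.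
  move=> Ne s Ns.
  (* Shifting by N keeps every index beyond N, as n_(k+N) >= k + N. All terms then have integral at
     most [e], and so does their lower limit, by Fatou. *)
  pose g k w := ((X s w - Y (k + N)%N w) ^+ 2)%:E.
  have mg k : measurable_fun setT (g k).
    apply/measurable_EFinP; apply: measurable_funX; exact: measurable_funB (mX _) (mX _).
  have g0 k w : (0 <= g k w)%E by rewrite lee_fin sqr_ge0.
  apply: (@le_trans _ _ (\int[Pr]_w limn_einf (g^~ w))%E).
    apply: ae_ge0_le_integral => //.
    - by move=> w _; rewrite lee_fin sqr_ge0.
    - apply/measurable_EFinP; apply: measurable_funX; exact: measurable_funB (mX _) mL.
    - move=> w _; rewrite limn_einf_lim; apply: lime_ge; first exact: is_cvg_einfs.
      by apply: nearW => k; apply: le_ereal_inf_tmp => _ [j _ <-].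
    - have -> : (fun w => limn_einf (g^~ w)) =
          (fun w => - limn_esup (fun k => - g k w))%E by [].
      apply: measurableT_comp => //; apply: measurable_fun_limn_esup => k.
      exact: measurableT_comp.
    apply: filterS cvgL => w YL _.
    have YNL : Y (k + N)%N w @[k --> \oo] --> L w by rewrite (cvg_shiftn N (fun k => Y k w)).
    have XYL : X s w - Y (k + N)%N w @[k --> \oo] --> X s w - L w.
      by apply: cvgB => //; exact: cvg_cst.
    have lim : g k w @[k --> \oo] --> ((X s w - L w) ^+ 2)%:E.
      apply: cvg_EFin; first exact: nearW.
      by rewrite /comp /= expr2; under eq_fun do rewrite expr2; exact: cvgM.
    by rewrite (cvg_limn_einf_sup lim).1.
  apply: le_trans (fatou _ _ _ _) _ => //.
  apply: limn_einf_le => k; rewrite /g -EFin_Rintegral; last first.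
    by apply: Lfun2X_integrable; exact: XB.
  by rewrite lee_fin; apply: Ne => //; rewrite (leq_trans _ (n_ge _))// leq_addl.
have XL2 e N : (forall s t, (N <= s)%N -> (N <= t)%N ->
     \int[Pr]_w ((X t w - X s w) ^+ 2) <= e) -> forall s, (N <= s)%N ->
    X s \- L \in Lfun Pr 2%:E.
  move=> Ne s Ns; apply: sqr_integrable_Lfun2; first exact: measurable_funB (mX _) mL.
  apply/integrableP; split.
    apply/measurable_EFinP; apply: measurable_funX; exact: measurable_funB (mX _) mL.
  apply: (@le_lt_trans _ _ e%:E); last exact: ltry.
  apply: le_trans (key _ _ Ne _ Ns).
  by rewrite le_eqVlt; apply/orP; left; apply/eqP/eq_integral => w _ /=; rewrite ger0_norm ?sqr_ge0.
exists L.
  have [N NP] := cauchy 1 ltr01.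
  rewrite (_ : L = fun w => X N w - (X N \- L) w).
    by apply: Lfun2B => //; exact: XL2 NP _ _.
  by apply/funext => w /=; rewrite opprB addrC subrK.
move=> e e0; have [N NP] := cauchy e e0; exists N => s Ns.
rewrite -lee_fin EFin_Rintegral; first exact: key NP _ _.
exact: Lfun2X_integrable (XL2 _ _ NP _ Ns).
Qed.

End L2Completeness.

(** * Scalar recursions *)

Section RealRecursions.
Context (R : realType).
Implicit Types (v b c : nat -> R).

Lemma cvg_series_tail c : cvgn (series c) ->
  forall e, 0 < e -> exists N, forall s t, (N <= s)%N -> (N <= t)%N ->
    \sum_(s <= k < t) c k <= e.
Proof.
move=> /cvg_cauchy/cauchy_seriesP cc e e0.
have [[A B] /= [[N1 _ N1A] [N2 _ N2B]] AB] := cc e e0.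
exists (maxn N1 N2) => s t; rewrite !geq_max => /andP[s1 s2] /andP[t1 t2].
have /= := AB (s, t) (conj (N1A _ s1) (N2B _ t2)).
by move=> /ltW; apply: le_trans; exact: ler_norm.
Qed.

Lemma nneg_partial_sum_le_lim c s : cvgn (series c) -> (forall k, 0 <= c k) ->
  \sum_(0 <= k < s) c k <= limn (series c).
Proof.
move=> cc c0; apply: (nondecreasing_cvgn_le _ cc s).
by move=> m n mn; apply: nondecreasing_series.
Qed.

(** Discrete Gronwall inequality. Adding 1 absorbs the inhomogeneous term, v_(s+1) + 1 <= (1 + K
    b_s)(v_s + 1), and 1 + x <= exp x turns the product into the exponential of a bounded sum. *)
Lemma growth_bounded v b (K : R) : 0 <= K -> (forall k, 0 <= b k) ->
  cvgn (series b) -> (forall s, v s.+1 <= (1 + K * b s) * v s + K * b s) ->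
  exists M, forall s, v s <= M.
Proof.
move=> K0 b0 cb vS.
have bnd s : v s + 1 <= (`|v 0%N| + 1) * expR (K * \sum_(0 <= k < s) b k).
  elim: s => [|s IH]; first by rewrite big_nil mulr0 expR0 mulr1 lerD2r ler_norm.
  have -> : v s.+1 + 1 = v s.+1 - ((1 + K * b s) * v s + K * b s)
    + (1 + K * b s) * (v s + 1) by ring.
  rewrite big_nat_recr//= [K * (_ + _)]mulrDr expRD mulrA.
  have Kb : 0 <= 1 + K * b s by rewrite addr_ge0// mulr_ge0.
  apply: (@le_trans _ _ ((1 + K * b s) * (v s + 1))).
    by rewrite gerDr subr_le0.
  rewrite [leRHS]mulrC; apply: (le_trans (ler_wpM2l Kb IH)).
  by rewrite ler_wpM2r ?expR_ge1Dx// mulr_ge0 ?expR_ge0// addr_ge0.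
exists ((`|v 0%N| + 1) * expR (K * limn (series b))) => s.
apply: (@le_trans _ _ (v s + 1)); first by rewrite lerDl.
apply: (le_trans (bnd s)); rewrite ler_wpM2l ?addr_ge0// ler_expR ler_wpM2l//.
exact: nneg_partial_sum_le_lim.
Qed.

(** The factor 1 - beta b_s may be negative, but 1 - x <= exp(-x) holds for every real x and v is
    nonnegative. Starting where the tail of c is at most e/2, the divergence of the sum of b makes
    the remaining exponential factor small. *)
Lemma contraction_cvg0 v b c (beta : R) : 0 < beta ->
  (forall k, 0 <= v k) -> (forall k, 0 <= b k) ->
  (forall M, exists N, M <= \sum_(0 <= k < N) b k) ->
  (forall k, 0 <= c k) -> cvgn (series c) ->
  (forall s, v s.+1 <= (1 - beta * b s) * v s + c s) ->
  forall e, 0 < e -> exists N, forall s, (N <= s)%N -> v s <= e.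
Proof.
move=> beta0 v0 b0 bdvg c0 cc vS e e0.
have e20 : 0 < e / 2 by rewrite divr_gt0.
have [s tail] := cvg_series_tail cc e20.
have bnd t : v (s + t)%N <= expR (- (beta * \sum_(s <= k < s + t) b k)) * v s
    + \sum_(s <= k < s + t) c k.
  elim: t => [|t IH].
    by rewrite addn0 !big_geq// mulr0 oppr0 expR0 mul1r addr0.
  rewrite addnS !big_nat_recr ?leq_addr//=.
  set E := \sum_(s <= k < s + t) b k in IH *; set F := \sum_(_ <= _ < _) c _ in IH *.
  have F0 : 0 <= F by rewrite sumr_ge0.
  rewrite [beta * (_ + _)]mulrDr opprD expRD addrA.
  apply: (le_trans (vS _)); rewrite lerD2r.
  apply: (@le_trans _ _ (expR (- (beta * b (s + t)%N)) * v (s + t)%N)).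
    by rewrite ler_wpM2r// expR_ge1Dx.
  apply: (le_trans (ler_wpM2l (expR_ge0 _) IH)).
  rewrite mulrDr mulrA [X in X * v s]mulrC lerD2l.
  by rewrite -[leRHS]mul1r ler_wpM2r// -expR0 ler_expR oppr_le0 mulr_ge0// (ltW beta0).
(* The sum S of b from s on must satisfy v_s exp(-beta S) <= e/2; since exp x >= x, it suffices that
   S >= v_s / (beta e/2). *)
have [N bN] := bdvg (\sum_(0 <= k < s) b k + v s / (beta * (e / 2))).
exists (maxn N s) => t; rewrite geq_max => /andP[Nt st].
rewrite -(subnKC st); apply: le_trans (bnd _) _; rewrite subnKC// [leRHS]splitr.
apply: lerD; last exact: tail.
have big : v s / (beta * (e / 2)) <= \sum_(s <= k < t) b k.
  rewrite -(lerD2l (\sum_(0 <= k < s) b k)) -big_cat_nat//=.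
  apply: (le_trans bN); rewrite (big_cat_nat (n := N) (p := t))//= lerDl.
  by rewrite sumr_ge0.
have [->|vs0] := eqVneq (v s) 0; first by rewrite mulr0 ltW.
have {}vs0 : 0 < v s by rewrite lt_def vs0 v0.
rewrite expRN mulrC ler_pdivrMr ?expR_gt0//.
move: big; rewrite ler_pdivrMr ?mulr_gt0// => big.
apply: (le_trans big); set S := \sum_(_ <= _ < _) _.
rewrite (_ : S * (beta * (e / 2)) = (e / 2) * (beta * S)); last by ring.
rewrite ler_wpM2l ?(ltW e20)//.
by apply: le_trans (expR_ge1Dx _); rewrite lerDr.
Qed.

End RealRecursions.

(** * Complex vectors and triangular matrices *)

Lemma size_index_enum_ord n : size (index_enum 'I_n) = n.
Proof. by rewrite -[RHS]card_ord -sum1_card -sum1_size. Qed.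

Section ComplexPlane.
Context (R : realType).
Implicit Types z w : R[i].

(** The real part of z times the conjugate of w, that is, the inner product of the plane. *)
Definition cdot z w : R := complex.Re z * complex.Re w + complex.Im z * complex.Im w.
Definition sqn z : R := cdot z z.

Lemma complex_ReD z w : complex.Re (z + w) = complex.Re z + complex.Re w.
Proof. by case: z; case: w. Qed.

Lemma complex_ImD z w : complex.Im (z + w) = complex.Im z + complex.Im w.
Proof. by case: z; case: w. Qed.

Lemma complex_ReB z w : complex.Re (z - w) = complex.Re z - complex.Re w.
Proof. by case: z; case: w. Qed.

Lemma complex_ImB z w : complex.Im (z - w) = complex.Im z - complex.Im w.
Proof. by case: z; case: w. Qed.

Lemma complex_ReM z w : complex.Re (z * w) =
  complex.Re z * complex.Re w - complex.Im z * complex.Im w.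
Proof. by case: z; case: w. Qed.

Lemma complex_ImM z w : complex.Im (z * w) =
  complex.Re z * complex.Im w + complex.Im z * complex.Re w.
Proof. by case: z; case: w. Qed.

Lemma complex_Re_sum (I : Type) (r : seq I) (P : pred I) (F : I -> R[i]) :
  complex.Re (\sum_(i <- r | P i) F i) = \sum_(i <- r | P i) complex.Re (F i).
Proof. by apply: (big_morph _ complex_ReD). Qed.

Lemma complex_Im_sum (I : Type) (r : seq I) (P : pred I) (F : I -> R[i]) :
  complex.Im (\sum_(i <- r | P i) F i) = \sum_(i <- r | P i) complex.Im (F i).
Proof. by apply: (big_morph _ complex_ImD). Qed.

Lemma sqn_ge0 z : 0 <= sqn z.
Proof. by rewrite /sqn /cdot -!expr2 addr_ge0// sqr_ge0. Qed.

Lemma sqnE z : sqn z = complex.Re z ^+ 2 + complex.Im z ^+ 2.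
Proof. by rewrite !expr2. Qed.

Lemma cdot_sumr (I : Type) (r : seq I) (P : pred I) z (F : I -> R[i]) :
  cdot z (\sum_(i <- r | P i) F i) = \sum_(i <- r | P i) cdot z (F i).
Proof. by rewrite /cdot complex_Re_sum complex_Im_sum !mulr_sumr -big_split. Qed.

Lemma sqnM z w : sqn (z * w) = sqn z * sqn w.
Proof. rewrite /sqn /cdot !complex_ReM !complex_ImM; ring. Qed.

Lemma sqn_addZ z w (a : R) :
  sqn (z + a%:C * w) = sqn z + 2 * a * cdot z w + a ^+ 2 * sqn w.
Proof. rewrite /sqn /cdot !complex_ReD !complex_ImD !complex_ReM !complex_ImM /=; ring. Qed.

Lemma sqnD_le z w : sqn (z + w) <= 2 * sqn z + 2 * sqn w.
Proof.
rewrite -subr_ge0 (_ : _ - _ = sqn (z - w)) ?sqn_ge0//.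
rewrite /sqn /cdot; case: z => ? ?; case: w => ? ? /=; ring.
Qed.

Lemma cdot_young z w (g : R) : 0 < g -> cdot z w <= g * sqn z + g^-1 * sqn w.
Proof.
move=> g0; rewrite -subr_ge0.
have -> : g * sqn z + g^-1 * sqn w - cdot z w =
    2^-1 * (g * sqn z + g^-1 * sqn w + g^-1 * sqn (g%:C * z - w)).
  rewrite /sqn /cdot; case: z => ? ?; case: w => ? ? /=; field.
  by rewrite gt_eqF.
by rewrite mulr_ge0 ?addr_ge0 ?mulr_ge0 ?sqn_ge0// ?invr_ge0// ltW.
Qed.

(** Each further summand costs a factor 2. The constant is far from sharp, but it depends only on
    the number of summands, which is all that the estimates require. *)
Lemma sqn_sum_le (I : Type) (r : seq I) (F : I -> R[i]) :
  sqn (\sum_(i <- r) F i) <= 2 ^+ size r * \sum_(i <- r) sqn (F i).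
Proof.
elim: r => [|i r IH]; first by rewrite !big_nil /sqn /cdot /= !mulr0 addr0.
rewrite !big_cons /=; apply: (le_trans (sqnD_le _ _)).
rewrite [leRHS]mulrDr lerD//.
  by rewrite ler_wpM2r ?sqn_ge0// exprS ler_peMr// exprn_ege1// ler1n.
by rewrite exprS -mulrA ler_wpM2l.
Qed.

Lemma sqr_sum_le (I : Type) (r : seq I) (F : I -> R) :
  (\sum_(i <- r) F i) ^+ 2 <= 2 ^+ size r * \sum_(i <- r) F i ^+ 2.
Proof.
have -> : (\sum_(i <- r) F i) ^+ 2 = sqn (\sum_(i <- r) (F i)%:C).
  by rewrite sqnE complex_Re_sum complex_Im_sum /= big1_eq expr0n addr0.
apply: (le_trans (sqn_sum_le _ _)); rewrite ler_wpM2l// ?exprn_ge0//.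
by apply: ler_sum => i _; rewrite sqnE /= expr0n addr0.
Qed.

Lemma sqn_mulmx_le p q (A : 'M[R[i]]_(p, q)) :
  exists2 K : R, 0 <= K & forall z : 'cV[R[i]]_q,
    \sum_i sqn ((A *m z) i 0) <= K * \sum_j sqn (z j 0).
Proof.
pose S := \sum_i \sum_j sqn (A i j).
have S0 : 0 <= S by rewrite !sumr_ge0// => i _; rewrite sumr_ge0// => j _; exact: sqn_ge0.
exists (p%:R * (2 ^+ q * S)) => [|z]; first by rewrite !mulr_ge0.
have bnd i : sqn ((A *m z) i 0) <= 2 ^+ q * S * \sum_j sqn (z j 0).
  rewrite mxE; apply: (le_trans (sqn_sum_le _ _)).
  rewrite size_index_enum_ord -mulrA ler_wpM2l ?exprn_ge0//.
  rewrite mulr_sumr; apply: ler_sum => j _; rewrite sqnM ler_wpM2r ?sqn_ge0//.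
  rewrite /S (bigD1 i)//= (bigD1 j)//= -addrA lerDl addr_ge0// sumr_ge0// => k _.
    exact: sqn_ge0.
  by rewrite sumr_ge0// => l _; exact: sqn_ge0.
apply: (le_trans (ler_sum _ (fun i _ => bnd i))).
by rewrite sumr_const card_ord mulr_natl mulrnAl.
Qed.

(* Geometric weights growing along the triangle absorb the strictly upper
   triangular part of [B] into its diagonal. *)
Lemma triangular_lyapunov m (B : 'M[R[i]]_m) (beta : R) : 0 < beta ->
  (forall i j : 'I_m, (j < i)%N -> B i j = 0) ->
  (forall i, complex.Re (B i i) <= - beta) ->
  exists2 wt : 'I_m -> R, (forall i, 1 <= wt i) & forall z : 'cV[R[i]]_m,
    \sum_i wt i * cdot (z i 0) ((B *m z) i 0) <=
    - (beta / 2) * \sum_i wt i * sqn (z i 0).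
Proof.
move=> beta0 Btri Bdiag.
(* Of the decay beta on the diagonal, beta/4 may be spent on Young's inequality: a row pays [g] at
   most m times. The off-diagonal entries may spend another beta/4, which leaves beta/2. *)
pose g := beta / 4 / m.+1%:R.
have g0 : 0 < g by rewrite !divr_gt0.
pose S := \sum_i \sum_j sqn (B i j).
have sB i j : sqn (B i j) <= S.
  rewrite /S (bigD1 i)//= (bigD1 j)//= -addrA lerDl addr_ge0// sumr_ge0// => k _.
    exact: sqn_ge0.
  by rewrite sumr_ge0// => l _; exact: sqn_ge0.
have S0 : 0 <= S by rewrite !sumr_ge0// => i _; rewrite sumr_ge0// => j _; exact: sqn_ge0.
pose C := g^-1 * S.
have C0 : 0 <= C by rewrite mulr_ge0// invr_ge0 ltW.
(* By the geometric sum, C times the weights below j equals beta/4 ((1 + kap)^j - 1), hence is at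
   most beta/4 [wt j]. *)
pose kap := C / (beta / 4).
have kap0 : 0 <= kap by rewrite divr_ge0// divr_ge0// ltW.
pose wt (i : 'I_m) := (1 + kap) ^+ i.
have wt0 i : 0 <= wt i by rewrite exprn_ge0// addr_ge0.
exists wt => [i|z]; first by rewrite exprn_ege1// lerDl.
have wsum (j : 'I_m) : C * \sum_(i < m | (i < j)%N) wt i <= beta / 4 * wt j.
  have -> : C = beta / 4 * kap by rewrite /kap mulrC divfK// gt_eqF// divr_gt0.
  rewrite -[leLHS]mulrA ler_wpM2l ?divr_ge0 ?(ltW beta0)//.
  rewrite (big_ord_narrow (ltnW (ltn_ord j))) /wt /=.
  have := subrX1 (1 + kap) j.
  rewrite (_ : 1 + kap - 1 = kap); last by ring.
  move=> e.
  by rewrite -e lerBlDr lerDl.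
have term (i j : 'I_m) : cdot (z i 0) (B i j * z j 0) <=
    (if i == j then - beta * sqn (z i 0) else 0) + g * sqn (z i 0)
    + (if (i < j)%N then C * sqn (z j 0) else 0).
  have gs : 0 <= g * sqn (z i 0) by rewrite mulr_ge0 ?sqn_ge0 ?ltW.
  case: ltngtP => [ij|ij|/val_inj ij].
  - have -> : (i == j) = false by apply/negP => /eqP e; rewrite e ltnn in ij.
    rewrite add0r; apply: (le_trans (cdot_young _ _ g0)); rewrite lerD2l sqnM.
    rewrite mulrA ler_wpM2r ?sqn_ge0// ler_wpM2l ?invr_ge0// ltW//.
  - have -> : (i == j) = false by apply/negP => /eqP e; rewrite e ltnn in ij.
    by rewrite Btri// mul0r /cdot /= !mulr0 !addr0 add0r.
  - rewrite ij eqxx addr0 -ij.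
    have -> : cdot (z i 0) (B i i * z i 0) = complex.Re (B i i) * sqn (z i 0).
      by rewrite /sqn /cdot complex_ReM complex_ImM; ring.
    rewrite -[leLHS]addr0 lerD// ler_wpM2r ?sqn_ge0//.
have row (i : 'I_m) : cdot (z i 0) ((B *m z) i 0) <=
    - (beta * (3 / 4)) * sqn (z i 0) + C * \sum_(j < m | (i < j)%N) sqn (z j 0).
  rewrite mxE cdot_sumr; apply: (le_trans (ler_sum _ (fun j _ => term i j))).
  rewrite [leLHS]big_split [X in X + _ <= _]big_split /= -!big_mkcond /=.
  rewrite -[\sum_(j < m | (i < j)%N) (C * _)]mulr_sumr lerD2r.
  rewrite (big_pred1 i) => [|j]; last by rewrite eq_sym.
  rewrite sumr_const card_ord -[X in _ + X <= _]mulr_natl.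
  rewrite -subr_ge0; set s := sqn (z i 0).
  have -> : - (beta * (3 / 4)) * s - (- beta * s + m%:R * (g * s)) =
      beta / 4 * (1 - m%:R / m.+1%:R) * s.
    by rewrite /g; move: (m.+1%:R^-1) => q; field.
  rewrite mulr_ge0 ?sqn_ge0// mulr_ge0 ?divr_ge0 ?(ltW beta0)// subr_ge0.
  by rewrite ler_pdivrMr// mul1r ler_nat.
apply: (le_trans (ler_sum _ (fun i _ => ler_wpM2l (wt0 i) (row i)))).
under eq_bigr do rewrite mulrDr.
rewrite big_split /=.
(* The off-diagonal costs are regrouped by column, so that coordinate j pays for all rows above
   it. *)
have -> : \sum_i wt i * (C * \sum_(j < m | (i < j)%N) sqn (z j 0)) =
    \sum_(j < m) (C * \sum_(i < m | (i < j)%N) wt i) * sqn (z j 0).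
  under eq_bigr do rewrite mulrCA mulr_sumr mulr_sumr.
  rewrite (exchange_big_dep predT)//=; apply: eq_bigr => j _.
  by rewrite mulr_sumr mulr_suml; apply: eq_bigr => i _; rewrite mulrA.
rewrite mulr_sumr -big_split; apply: ler_sum => i _ /=.
have : C * (\sum_(i0 < m | (i0 < i)%N) wt i0) * sqn (z i 0) <=
    beta / 4 * wt i * sqn (z i 0) by rewrite ler_wpM2r ?sqn_ge0.
lra.
Qed.

End ComplexPlane.

(** * Spectral consequences of the Jordan form and of (A3) *)

Section Spectrum.
Context (R : realType).

Lemma jordan_normal_form_upper n (D : 'M[R[i]]_n) : jordan_normal_form D ->
  forall i j : 'I_n, (j < i)%N -> D i j = 0.
Proof.
move=> [q [k [l [e [_ ->]]]]].
(* [is_trig_mx] means lower triangular, hence the transpose. *)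
suff tri : is_trig_mx (\mxdiag_(i < q) jordan_block (k i) (l i))^T.
  case: _ / e => i j ji; rewrite castmx_id.
  by move/is_trig_mxP : tri => /(_ j i ji); rewrite mxE.
rewrite tr_mxdiag; apply/is_trig_mxblockP; split=> [i j ij|i].
  by rewrite /= (negPf (_ : i != j)) // -val_eqE ltn_eqF.
rewrite eqxx conform_mx_id; apply/is_trig_mxP => i1 i2 lt12.
rewrite !mxE -val_eqE gtn_eqF//= mulr0n add0r.
by rewrite gtn_eqF// ltnS ltnW.
Qed.

Lemma char_poly_upper n (D : 'M[R[i]]_n) :
  (forall i j : 'I_n, (j < i)%N -> D i j = 0) ->
  char_poly D = \prod_(i < n) ('X - (D i i)%:P).
Proof.
move=> Dup; rewrite -[LHS](det_tr (char_poly_mx D)).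
have -> : (char_poly_mx D)^T = char_poly_mx D^T.
  by rewrite /char_poly_mx linearB /= tr_scalar_mx map_trmx.
rewrite -/(char_poly _) char_poly_trig; last first.
  by apply/is_trig_mxP => i j ij; rewrite mxE Dup.
by apply: eq_bigr => i _; rewrite mxE.
Qed.

Lemma char_poly_conj n (H D : 'M[R[i]]_n) : H \in unitmx ->
  char_poly (invmx H *m D *m H) = char_poly D.
Proof.
move=> uH; rewrite /char_poly.
have -> : char_poly_mx (invmx H *m D *m H) =
    map_mx polyC (invmx H) *m char_poly_mx D *m map_mx polyC H.
  rewrite /char_poly_mx mulmxBr mulmxBl !map_mxM /=; congr (_ - _).
  by rewrite scalar_mxC -mulmxA -map_mxM mulVmx// map_mx1 mulmx1.
rewrite !det_mulmx mulrAC -det_mulmx -map_mxM mulVmx// map_mx1 det1.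
by rewrite mul1r.
Qed.

Context (r m : nat) (P : 'M[R]_(r + m)) (u : 'cV[R]_(r + m)).
Context (H D : 'M[R[i]]_(r + m)) (Dl : 'M[R[i]]_m).
Hypothesis A3Pu : A3 P u.
Hypothesis r_mult : r = alg_mult (cplx_mx P) 1.
Hypothesis uH : H \in unitmx.
Hypothesis PHD : cplx_mx P = invmx H *m D *m H.
Hypothesis jD : jordan_normal_form D.
Hypothesis DE : D = block_mx 1%:M 0 0 Dl.

Lemma jordan_rest_upper (i j : 'I_m) : (j < i)%N -> Dl i j = 0.
Proof.
move=> ji; have := jordan_normal_form_upper jD (i := rshift r i) (j := rshift r j).
by rewrite /= ltn_add2l => /(_ ji); rewrite DE block_mxEdr.
Qed.

Lemma char_poly_jordan :
  char_poly (cplx_mx P) = ('X - 1) ^+ r * \prod_(i < m) ('X - (Dl i i)%:P).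
Proof.
rewrite PHD char_poly_conj// char_poly_upper; last exact: jordan_normal_form_upper.
rewrite big_split_ord /=; congr (_ * _).
  rewrite (eq_bigr (fun=> 'X - 1)); first by rewrite prodr_const card_ord.
  by move=> i _; rewrite DE block_mxEul mxE eqxx.
by apply: eq_bigr => i _; rewrite DE block_mxEdr.
Qed.

Lemma jordan_rest_root (i : 'I_m) : root (char_poly (cplx_mx P)) (Dl i i).
Proof.
rewrite char_poly_jordan rootM; apply/orP; right.
by rewrite (bigD1 i)//= rootM root_XsubC eqxx.
Qed.

(** Otherwise (X - 1)^(r+1) would divide the characteristic polynomial, against the choice of r as
    the algebraic multiplicity of 1. *)
Lemma jordan_rest_neq1 (i : 'I_m) : Dl i i != 1.
Proof.
apply/eqP => Di; have p0 : char_poly (cplx_mx P) != 0.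
  exact/monic_neq0/char_poly_monic.
have : (r.+1 <= mup 1 (char_poly (cplx_mx P)))%N.
  rewrite mup_geq// char_poly_jordan exprSr dvdp_mul//.
  by rewrite (bigD1 i)//= Di dvdp_mulr.
by rewrite -/(alg_mult _ _) -r_mult ltnn.
Qed.

Lemma jordan_rest_Re_neq1 (i : 'I_m) : complex.Re (Dl i i) != 1.
Proof.
apply/eqP => Re1; have := jordan_rest_neq1 i; case: A3Pu => l1 _ _.
by rewrite (l1 _ _ Re1) ?eqxx// eigenvalue_root_char jordan_rest_root.
Qed.

Lemma mem_eigenvalues (l : R[i]) :
  root (char_poly (cplx_mx P)) l -> l \in eigenvalues P.
Proof.
rewrite /eigenvalues; case: closed_field_poly_normal => s /= ->.
by rewrite (monicP (char_poly_monic _)) scale1r root_prod_XsubC.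
Qed.

(** The value of [rho_max] or [rho_min] puts all real parts on one side of 1, and [sg] records the
    side. None equals 1 by (A3), and there are finitely many, so the distance to 1 has a positive
    minimum. *)
Lemma spectral_gap (sg : R) :
  sg = 1 /\ rho_max P = 1 \/ sg = -1 /\ rho_min P = 1 ->
  exists2 beta : R, 0 < beta &
    forall i, sg * (complex.Re (Dl i i) - 1) <= - beta.
Proof.
move=> rho; pose f i := `|complex.Re (Dl i i) - 1|.
(* The initial value 1 keeps the minimum positive when m = 0. *)
exists (\big[Num.min/1]_i f i).
  apply/bigmin_gtP; split => // i _.
  by rewrite normr_gt0 subr_eq0 jordan_rest_Re_neq1.
move=> i; rewrite lerNr; apply: (le_trans (bigmin_le _ i _)) => //.
have Dmem := mem_eigenvalues (jordan_rest_root i).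
case: rho => [[-> rmax]|[-> rmin]].
- rewrite mul1r /f ler0_norm// subr_le0 -rmax.
  by rewrite /rho_max; apply: (@le_bigmax_seq _ _ _ _ _ (Dl i i) xpredT (@complex.Re R)).
- rewrite mulN1r opprK /f ger0_norm// subr_ge0 -rmin.
  by rewrite /rho_min; apply: (@ge_bigmin_seq _ _ _ _ _ (Dl i i) xpredT (@complex.Re R)).
Qed.

Lemma jordan_rest_unit : (1%:M - Dl) \in unitmx.
Proof.
rewrite unitmxE -det_tr det_trig; last first.
  apply/is_trig_mxP => i j ij; rewrite !mxE jordan_rest_upper//.
  by rewrite -val_eqE gtn_eqF// subr0.
rewrite unitfE; apply/prodf_neq0 => i _.
by rewrite !mxE eqxx subr_eq0 eq_sym jordan_rest_neq1.
Qed.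

Lemma jordan_mulmx : H *m cplx_mx P = D *m H.
Proof. by rewrite PHD !mulmxA mulmxV// mul1mx. Qed.

(** From H P = D H, the first r rows of H are left eigenvectors of P for the eigenvalue 1. They are
    nonzero because H is invertible, so (A3) applies to each. *)
Lemma usubmx_forcing0 : usubmx (H *m cplx_mx u) = 0.
Proof.
apply/matrixP => i j; rewrite ord1 !mxE.
case: A3Pu => _ _ /(_ (row (lshift m i) H)) xi0.
have rowH : row (lshift m i) H != 0.
  apply/eqP => row0; have : row (lshift m i) (H *m invmx H) 0 (lshift m i) = 0.
    by rewrite row_mul row0 mul0mx mxE.
  by rewrite mulmxV// !mxE eqxx => /eqP; rewrite oner_eq0.
have : row (lshift m i) H *m cplx_mx u = 0.
  apply: xi0 => //; rewrite -row_mul jordan_mulmx row_mul scale1r [RHS]rowE.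
  congr (_ *m _); apply/matrixP => a b; rewrite ord1 DE mxE.
  rewrite -[b]fintype.splitK; case: (fintype.split b) => c /=.
    by rewrite block_mxEul !mxE eq_lshift eqxx eq_sym.
  by rewrite block_mxEur !mxE eq_rlshift.
move=> /(congr1 (fun M : 'cV[R[i]]_1 => M 0 0)); rewrite !mxE => e.
by rewrite -[RHS]e; apply: eq_bigr => k _; rewrite !mxE.
Qed.

End Spectrum.

(** * The noise of the system *)

Section MatrixNorm.
Context (R : realType).

Lemma norm2_sqr n (v : 'cV[R]_n) : norm2 v ^+ 2 = \sum_i v i 0 ^+ 2.
Proof. by rewrite sqr_sqrtr// sumr_ge0// => i _; exact: sqr_ge0. Qed.

Lemma entry_sqr_le_norm2 n (v : 'cV[R]_n) i : v i 0 ^+ 2 <= norm2 v ^+ 2.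
Proof.
by rewrite norm2_sqr (bigD1 i)//= lerDl sumr_ge0// => j _; exact: sqr_ge0.
Qed.

(** The entry is a coordinate of the image of a basis vector, which has norm 1. *)
Lemma entry_sqr_le_mx_norm2 n (A : 'M[R]_n) i j : A i j ^+ 2 <= mx_norm2 A ^+ 2.
Proof.
pose e : 'cV[R]_n := delta_mx j 0.
have ne : norm2 e = 1.
  apply/eqP; rewrite -(@pexpr_eq1 _ _ 2)// ?sqrtr_ge0// norm2_sqr (bigD1 j)//=.
  rewrite mxE !eqxx expr1n big1 ?addr0// => k kj.
  by rewrite mxE (negPf kj) expr0n.
have -> : A i j = (A *m e) i 0 by rewrite -colE mxE.
apply: (le_trans (entry_sqr_le_norm2 _ _)).
have n0 (v : 'cV[R]_n) : 0 <= norm2 v by exact: sqrtr_ge0.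
suff ub : norm2 (A *m e) <= mx_norm2 A.
  by rewrite lerXn2r ?nnegrE// (le_trans (n0 _) ub).
apply: sup_upper_bound; last by exists e => //=; rewrite ne.
split; first by exists (norm2 (A *m e)), e => //=; rewrite ne.
(* A bound on the image of the unit ball is required, since only then is [sup] an upper bound. *)
exists (Num.sqrt (\sum_(k < n) (2 ^+ n * \sum_(l < n) A k l ^+ 2))) => _ [v /= v1 <-].
apply: ler_wsqrtr; apply: ler_sum => k _; rewrite mxE.
apply: (le_trans (sqr_sum_le _ _)).
rewrite size_index_enum_ord ler_wpM2l ?exprn_ge0//; apply: ler_sum => l _.
rewrite exprMn -[leRHS]mulr1 ler_wpM2l ?sqr_ge0//.
apply: (le_trans (entry_sqr_le_norm2 _ _)).
by rewrite -[leRHS](expr1n _ 2) lerXn2r ?nnegrE.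
Qed.

End MatrixNorm.

Section Noise.
Context d (T : measurableType d) (R : realType) (Pr : probability T R) (n : nat).
Context (a : nat -> R) (Ps : nat -> T -> 'M[R]_n) (us : nat -> T -> 'cV[R]_n).
Context (P : 'M[R]_n) (u : 'cV[R]_n) (x0 : 'cV[R]_n) (x : nat -> T -> 'cV[R]_n).
Hypothesis mPs : forall s, random_mx (Ps s).
Hypothesis mus : forall s, random_mx (us s).
Hypothesis x_init : forall w, x 0%N w = x0.
Hypothesis x_rec : forall s w,
  x s.+1 w = (1 - a s) *: x s w + a s *: (Ps s w *m x s w + us s w).
Hypothesis A1x : A1 Pr x Ps us P u.

Local Notation L1 f := (Pr.-integrable [set: T] (EFin \o f)).
Local Notation L2 f := (f \in Lfun Pr 2%:E).

Definition noise s w : 'cV[R]_n := (Ps s w - P) *m x s w + (us s w - u).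

Lemma noise_rec s w :
  x s.+1 w = x s w + a s *: ((P - 1%:M) *m x s w + u) + a s *: noise s w.
Proof.
rewrite x_rec /noise !mulmxBl mul1mx.
by apply/matrixP => i j; move: (Ps s w *m _) (P *m _) => p q; rewrite !mxE; ring.
Qed.

Lemma state_entry_rec s w i : x s.+1 w i 0 =
  (1 - a s) * x s w i 0 + a s * (\sum_j Ps s w i j * x s w j 0 + us s w i 0).
Proof. by rewrite x_rec !mxE. Qed.

Lemma measurable_state s i : measurable_fun setT (fun w => x s w i 0).
Proof.
elim: s i => [|s IH] i.
  rewrite (_ : (fun _ => _) = cst (x0 i 0)) ?measurable_cst//.
  by apply/funext => w; rewrite x_init.
under eq_fun do rewrite state_entry_rec.
apply: measurable_funD; apply: measurable_funM => //.
apply: measurable_funD; last exact: mus.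
by apply: measurable_sum => j; apply: measurable_funM => //; exact: mPs.
Qed.

(** A generator of [sigma_vec (x s)], which thereby takes the form [<<s U >>] of the lemmas on
    conditional expectations; [past] plays the same role for [sigma_history x s]. *)
Let gen s : set_system T := \big[setU/set0]_(i < n)
  preimage_set_system setT (fun w => x s w i 0) measurable.

Let gen_state s i B : measurable B -> <<s gen s >> ((fun w => x s w i 0) @^-1` B).
Proof.
move=> mB; apply: sub_sigma_algebra; rewrite /gen (bigD1 i)//=; left.
by exists B => //; rewrite setTI.
Qed.

Let gen_measurable s : <<s gen s >> `<=` measurable.
Proof.
apply: smallest_sub; first exact: sigma_algebra_measurable.
rewrite /gen; apply: (big_ind (fun G => G `<=` measurable)) => //.
  by move=> A B Am Bm C [/Am|/Bm].
move=> i _ _ [B mB <-]; exact: measurable_state.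
Qed.

Let past s : set_system T := \bigcup_(k in `I_s.+1) sigma_vec (x k).

Let past_measurable s : <<s past s >> `<=` measurable.
Proof.
apply: smallest_sub; first exact: sigma_algebra_measurable.
by move=> A [k _]; exact: gen_measurable.
Qed.

Let measurable_state_past s t i : (t <= s)%N ->
  measurable_fun setT ((fun w => x t w i 0) : g_sigma_algebraType (past s) -> R).
Proof.
move=> ts _ B mB; rewrite setTI; apply: sub_sigma_algebra.
by exists t => //=; exact: gen_state.
Qed.

Let measurable_state_gen s i :
  measurable_fun setT ((fun w => x s w i 0) : g_sigma_algebraType (gen s) -> R).
Proof. by move=> _ B mB; rewrite setTI; exact: gen_state. Qed.

(** The weight x_j(s)^2 is measurable for the sigma-algebra of x(s), so conditioning on x(s) alone
    suffices here. Square integrability of the products is a conclusion; the premise on [x s] is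
    what the induction in [Lfun2_state] supplies. *)
Lemma second_moment_bounds : exists2 C : R, 0 <= C & forall s,
  (forall i j, L2 (fun w => x s w j 0) ->
     L2 (fun w => Ps s w i j * x s w j 0) /\
     \int[Pr]_w ((Ps s w i j * x s w j 0) ^+ 2) <=
       C * \int[Pr]_w (x s w j 0 ^+ 2)) /\
  (forall i, L2 (fun w => us s w i 0) /\ \int[Pr]_w (us s w i 0 ^+ 2) <= C).
Proof.
case: A1x => _ _ [C1 C1P] [C2 C2P].
pose C := Num.max (Num.max C1 0) (Num.max C2 0).
have C0 : 0 <= C by rewrite /C !le_max lexx orbT.
exists C => // s; split.
- move=> i j xL.
  pose Z w := x s w j 0 ^+ 2.
  have iZ : L1 Z by exact: Lfun2X_integrable.
  have mPx : measurable_fun setT (fun w => Ps s w i j * x s w j 0).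
    by apply: measurable_funM; [exact: mPs|exact: measurable_state].
  have le1 : (\int[Pr]_w ((Ps s w i j * x s w j 0) ^+ 2)%:E <=
      (Num.max C1 0 * \int[Pr]_w Z w)%:E)%E.
    apply: (@le_trans _ _ (\int[Pr]_w (mx_norm2 (Ps s w) ^+ 2 * Z w)%:E)%E).
      apply: ge0_le_integral => //.
      - by move=> w _; rewrite lee_fin sqr_ge0.
      - by apply/measurable_EFinP; exact: measurable_funX.
      - apply/measurable_EFinP; apply: measurable_funM.
          case: (C1P s) => g [ig _ _ _] _.
          by apply/measurable_EFinP; case/integrableP : ig.
        by apply: measurable_funX; exact: measurable_state.
      - move=> w _; rewrite lee_fin exprMn ler_wpM2r ?sqr_ge0//.
        exact: entry_sqr_le_mx_norm2.
    apply: (le_trans (cond_bounded_integral_mul (@gen_measurable s) _ (C1P s) _ _)).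
    - by move=> w; exact: sqr_ge0.
    - by apply: measurable_funX; exact: measurable_state_gen.
    - by move=> w; exact: sqr_ge0.
    - by rewrite -EFin_Rintegral ?RintegralZl//; exact: integrableZ_EFin.
  have L2Px : L2 (fun w => Ps s w i j * x s w j 0).
    apply: sqr_integrable_Lfun2 => //; apply/integrableP; split.
      by apply/measurable_EFinP; exact: measurable_funX.
    under eq_integral do rewrite /= ger0_norm ?sqr_ge0//.
    exact: (le_lt_trans le1 (ltry _)).
  split => //; rewrite -lee_fin EFin_Rintegral; last exact: Lfun2X_integrable.
  apply: (le_trans le1); rewrite lee_fin ler_wpM2r//.
    by apply: Rintegral_ge0 => w _; exact: sqr_ge0.
  by rewrite /C le_max lexx.
- move=> i.
  have mu : measurable_fun setT (fun w => us s w i 0) by exact: mus.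
  have le1 : (\int[Pr]_w (us s w i 0 ^+ 2)%:E <= (Num.max C2 0)%:E)%E.
    apply: (@le_trans _ _ (\int[Pr]_w (norm2 (us s w) ^+ 2 * 1)%:E)%E).
      apply: ge0_le_integral => //.
      - by move=> w _; rewrite lee_fin sqr_ge0.
      - by apply/measurable_EFinP; exact: measurable_funX.
      - apply/measurable_EFinP; apply: measurable_funM => //.
        case: (C2P s) => g [ig _ _ _] _.
        by apply/measurable_EFinP; case/integrableP : ig.
      - by move=> w _; rewrite lee_fin mulr1; exact: entry_sqr_le_norm2.
    apply: (le_trans (cond_bounded_integral_mul (Z := cst 1)
        (@gen_measurable s) _ (C2P s) _ _)) => //.
    - by move=> w; exact: sqr_ge0.
    - under eq_integral do rewrite /= mulr1.
      by rewrite integral_cst// [X in (_ * X)%E]probability_setT mule1.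
  have L2u : L2 (fun w => us s w i 0).
    apply: sqr_integrable_Lfun2 => //; apply/integrableP; split.
      by apply/measurable_EFinP; exact: measurable_funX.
    under eq_integral do rewrite /= ger0_norm ?sqr_ge0//.
    exact: (le_lt_trans le1 (ltry _)).
  split => //; rewrite -lee_fin EFin_Rintegral; last exact: Lfun2X_integrable.
  by apply: (le_trans le1); rewrite lee_fin /C le_max lexx orbT.
Qed.

Lemma Lfun2_state s i : L2 (fun w => x s w i 0).
Proof.
have [C _ CP] := second_moment_bounds.
elim: s i => [|s IH] i.
  rewrite (_ : (fun _ => _) = fun=> x0 i 0) ?Lfun2_cst//.
  by apply/funext => w; rewrite x_init.
under eq_fun do rewrite state_entry_rec.
apply: Lfun2D; apply: Lfun2Z => //; apply: Lfun2D; last exact: ((CP s).2 i).1.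
by apply: Lfun2_sum => j; exact: ((CP s).1 i j (IH j)).1.
Qed.

Lemma noiseE s w i : noise s w i 0 =
  \sum_j (Ps s w i j - P i j) * x s w j 0 + (us s w i 0 - u i 0).
Proof. by rewrite !mxE; congr (_ + _); apply: eq_bigr => j _; rewrite !mxE. Qed.

Let Lfun2_noise_summand s i j : L2 (fun w => (Ps s w i j - P i j) * x s w j 0).
Proof.
have [C _ CP] := second_moment_bounds.
under eq_fun do rewrite mulrBl.
apply: Lfun2B; first exact: ((CP s).1 i j (Lfun2_state s j)).1.
by apply: Lfun2Z; exact: Lfun2_state.
Qed.

Let Lfun2_noise_forcing s i : L2 (fun w => us s w i 0 - u i 0).
Proof.
have [C _ CP] := second_moment_bounds.
by apply: Lfun2B; [exact: ((CP s).2 i).1|exact: Lfun2_cst].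
Qed.

Lemma Lfun2_noise s i : L2 (fun w => noise s w i 0).
Proof. by under eq_fun do rewrite noiseE; apply: Lfun2D => //; exact: Lfun2_sum. Qed.

Lemma noise_second_moment : exists2 K : R, 0 <= K & forall s i,
  \int[Pr]_w (noise s w i 0 ^+ 2) <= K * (1 + \sum_j \int[Pr]_w (x s w j 0 ^+ 2)).
Proof.
have [C C0 CP] := second_moment_bounds.
pose SP := \sum_i \sum_j P i j ^+ 2; pose Su := \sum_i u i 0 ^+ 2.
have SP0 : 0 <= SP by apply: sumr_ge0 => i _; apply: sumr_ge0 => j _; exact: sqr_ge0.
have Su0 : 0 <= Su by apply: sumr_ge0 => i _; exact: sqr_ge0.
(* One factor 2 separates the matrix part from the forcing, another separates each random
   coefficient from its mean, and 2^n comes from the sum over the columns. *)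
pose K1 := 4 * 2 ^+ n * (C + SP); pose K2 := 4 * (C + Su).
have K10 : 0 <= K1 by rewrite !mulr_ge0 ?addr_ge0 ?exprn_ge0.
have K20 : 0 <= K2 by rewrite mulr_ge0 ?addr_ge0.
exists (K1 + K2) => [|s i]; first by rewrite addr_ge0.
have ix j : L1 (fun w => x s w j 0 ^+ 2) by apply/Lfun2X_integrable/Lfun2_state.
have iPx j : L1 (fun w => (Ps s w i j * x s w j 0) ^+ 2).
  by apply/Lfun2X_integrable; exact: ((CP s).1 i j (Lfun2_state s j)).1.
have iu : L1 (fun w => us s w i 0 ^+ 2).
  by apply/Lfun2X_integrable; exact: ((CP s).2 i).1.
pose bnd w := 4 * 2 ^+ n * (\sum_j ((Ps s w i j * x s w j 0) ^+ 2
   + SP * x s w j 0 ^+ 2)) + 4 * (us s w i 0 ^+ 2 + Su).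
have isum j : L1 (fun w => (Ps s w i j * x s w j 0) ^+ 2 + SP * x s w j 0 ^+ 2).
  by apply: integrableD_EFin => //; exact: integrableZ_EFin.
have ic (c : R) : L1 (fun=> c) by apply/Lfun2_integrable/Lfun2_cst.
have iuS : L1 (fun w => us s w i 0 ^+ 2 + Su) by exact: integrableD_EFin.
have ibnd : L1 bnd.
  apply: integrableD_EFin; apply: integrableZ_EFin => //.
  exact: integrable_sum_EFin.
have le_bnd w : noise s w i 0 ^+ 2 <= bnd w.
  have sq2 (p q : R) : (p + q) ^+ 2 <= 2 * (p ^+ 2 + q ^+ 2).
    by rewrite -subr_ge0 (_ : _ - _ = (p - q) ^+ 2) ?sqr_ge0//; ring.
  rewrite noiseE; apply: (le_trans (sq2 _ _)); rewrite mulrDr lerD//.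
    apply: (@le_trans _ _ (2 * (2 ^+ n * \sum_j ((Ps s w i j - P i j) * x s w j 0) ^+ 2))).
      rewrite ler_wpM2l//; apply: (le_trans (sqr_sum_le _ _)).
      by rewrite size_index_enum_ord.
    rewrite (_ : 4 * 2 ^+ n * _ = 2 * (2 ^+ n * (2 * \sum_j ((Ps s w i j * x s w j 0) ^+ 2
       + SP * x s w j 0 ^+ 2)))); last by ring.
    rewrite ler_wpM2l// ler_wpM2l ?exprn_ge0// mulr_sumr; apply: ler_sum => j _.
    rewrite mulrBl; apply: (le_trans (sq2 _ _)).
    rewrite ler_wpM2l// lerD2l sqrrN exprMn ler_wpM2r ?sqr_ge0//.
    rewrite /SP (bigD1 i)//= (bigD1 j)//= -addrA lerDl addr_ge0 ?sumr_ge0// => k _.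
      exact: sqr_ge0.
    by apply: sumr_ge0 => l _; exact: sqr_ge0.
  rewrite (_ : 4 * (us s w i 0 ^+ 2 + Su) = 2 * (2 * (us s w i 0 ^+ 2 + Su))); last by ring.
  rewrite ler_wpM2l//; apply: (le_trans (sq2 _ _)); rewrite ler_wpM2l// lerD2l sqrrN.
  by rewrite /Su (bigD1 i)//= lerDl sumr_ge0// => j _; exact: sqr_ge0.
apply: (@le_trans _ _ (\int[Pr]_w bnd w)).
  by apply: le_Rintegral => //; apply/Lfun2X_integrable/Lfun2_noise.
rewrite RintegralD//; last 2 first.
- by apply: integrableZ_EFin; exact: integrable_sum_EFin.
- exact: integrableZ_EFin.
rewrite !RintegralZl//; last exact: integrable_sum_EFin.
rewrite Rintegral_sum// RintegralD// Rintegral_cst_probability.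
set Sx := \sum_j \int[Pr]_w (x s w j 0 ^+ 2).
have Sx0 : 0 <= Sx.
  by apply: sumr_ge0 => j _; apply: Rintegral_ge0 => w _; exact: sqr_ge0.
apply: (@le_trans _ _ (K1 * Sx + K2)).
  rewrite lerD//; last by rewrite /K2 ler_wpM2l// lerD2r; exact: ((CP s).2 i).2.
  rewrite /K1 -[leRHS]mulrA ler_wpM2l ?mulr_ge0 ?exprn_ge0//.
  rewrite mulr_sumr; apply: ler_sum => j _.
  rewrite RintegralD//; last exact: integrableZ_EFin.
  rewrite mulrDl RintegralZl// lerD2r.
  exact: ((CP s).1 i j (Lfun2_state s j)).2.
rewrite mulrDr mulr1 mulrDl -subr_ge0.
rewrite (_ : _ - _ = K1 + K2 * Sx); last by ring.
by rewrite addr_ge0// mulr_ge0.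
Qed.

(** Every summand of the noise is a centred coefficient times a weight known at time s. The weight
    x_j Z need not be in L^2: integrability follows by regrouping, since the centred coefficient
    times x_j is in L^2 and so is Z. *)
Let noise_orthogonal s i (Z : T -> R) : L2 Z ->
  measurable_fun setT (Z : g_sigma_algebraType (past s) -> R) ->
  \int[Pr]_w (noise s w i 0 * Z w) = 0.
Proof.
move=> LZ mZ; case: A1x => AP Au _ _.
rewrite (eq_Rintegral Pr (g := fun w =>
  \sum_j (Ps s w i j - P i j) * (x s w j 0 * Z w) + (us s w i 0 - u i 0) * Z w)); last first.
  move=> w _; rewrite noiseE mulrDl mulr_suml; congr (_ + _).
  by apply: eq_bigr => j _; rewrite mulrA.
have i1 j : L1 (fun w => (Ps s w i j - P i j) * (x s w j 0 * Z w)).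
  by under eq_fun do rewrite mulrA; exact: Lfun2M_integrable.
have i2 : L1 (fun w => (us s w i 0 - u i 0) * Z w) by exact: Lfun2M_integrable.
rewrite RintegralD//; last exact: integrable_sum_EFin.
rewrite Rintegral_sum// big1 ?add0r => [|j _].
  have [ih h0] := cond_expect_cst_centered (@past_measurable s) (Au s i).
  exact: (cond_centered_mul (@past_measurable s) ih h0).
have [ih h0] := cond_expect_cst_centered (@past_measurable s) (AP s i j).
apply: (cond_centered_mul (@past_measurable s) ih h0) => //.
by apply: measurable_funM => //; exact: measurable_state_past.
Qed.

Lemma noise_orthogonal_state s t i k : (t <= s)%N ->
  \int[Pr]_w (noise s w i 0 * x t w k 0) = 0.
Proof.
by move=> ts; apply: noise_orthogonal; [exact: Lfun2_state|exact: measurable_state_past].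
Qed.

Lemma noise_centered s i : \int[Pr]_w noise s w i 0 = 0.
Proof.
rewrite (eq_Rintegral Pr (g := fun w => noise s w i 0 * 1)) => [|w _]; last first.
  by rewrite mulr1.
by apply: noise_orthogonal; [exact: Lfun2_cst|exact: measurable_cst].
Qed.

End Noise.

(** * Convergence in mean square *)

Section ComplexSquareIntegrable.
Context d (T : measurableType d) (R : realType) (Pr : probability T R).

Local Notation L1 f := (Pr.-integrable [set: T] (EFin \o f)).
Local Notation L2 f := (f \in Lfun Pr 2%:E).

Definition cLfun2 (Z : T -> R[i]) : Prop :=
  L2 (fun w => complex.Re (Z w)) /\ L2 (fun w => complex.Im (Z w)).

Lemma cLfun2_cst (c : R[i]) : cLfun2 (fun=> c).
Proof. by split; exact: Lfun2_cst. Qed.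

Lemma cLfun2_real (X : T -> R) : L2 X -> cLfun2 (fun w => (X w)%:C).
Proof. by move=> LX; split => //=; exact: Lfun2_cst. Qed.

Lemma cLfun2D (Z W : T -> R[i]) :
  cLfun2 Z -> cLfun2 W -> cLfun2 (fun w => Z w + W w).
Proof.
move=> [Z1 Z2] [W1 W2]; split.
  by under eq_fun do rewrite complex_ReD; exact: Lfun2D.
by under eq_fun do rewrite complex_ImD; exact: Lfun2D.
Qed.

Lemma cLfun2Z (Z : T -> R[i]) c : cLfun2 Z -> cLfun2 (fun w => c * Z w).
Proof.
move=> [Z1 Z2]; split.
  by under eq_fun do rewrite complex_ReM; apply: Lfun2B; exact: Lfun2Z.
by under eq_fun do rewrite complex_ImM; apply: Lfun2D; exact: Lfun2Z.
Qed.

Lemma cLfun2_sum (I : Type) (r : seq I) (F : I -> T -> R[i]) :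
  (forall i, cLfun2 (F i)) -> cLfun2 (fun w => \sum_(i <- r) F i w).
Proof.
move=> lF; elim: r => [|i r IH].
  by under eq_fun do rewrite big_nil; exact: cLfun2_cst.
by under eq_fun do rewrite big_cons; exact: cLfun2D.
Qed.

Lemma cLfun2_mulmx p q (A : 'M[R[i]]_(p, q)) (Z : T -> 'cV[R[i]]_q) i :
  (forall j, cLfun2 (fun w => Z w j 0)) -> cLfun2 (fun w => (A *m Z w) i 0).
Proof.
by move=> lZ; under eq_fun do rewrite mxE; apply: cLfun2_sum => j; exact: cLfun2Z.
Qed.

Lemma integrable_cdot (Z W : T -> R[i]) :
  cLfun2 Z -> cLfun2 W -> L1 (fun w => cdot (Z w) (W w)).
Proof.
by move=> [Z1 Z2] [W1 W2]; apply: integrableD_EFin; exact: Lfun2M_integrable.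
Qed.

Lemma integrable_sqn (Z : T -> R[i]) : cLfun2 Z -> L1 (fun w => sqn (Z w)).
Proof. by move=> lZ; exact: integrable_cdot. Qed.

Lemma integral_sqn_ge0 (Z : T -> R[i]) : 0 <= \int[Pr]_w sqn (Z w).
Proof. by apply: Rintegral_ge0 => w _; exact: sqn_ge0. Qed.

Lemma integral_sqnE (Z : T -> R[i]) : cLfun2 Z ->
  \int[Pr]_w sqn (Z w) =
  \int[Pr]_w (complex.Re (Z w) ^+ 2) + \int[Pr]_w (complex.Im (Z w) ^+ 2).
Proof.
by move=> [Z1 Z2]; rewrite -RintegralD//; exact: Lfun2X_integrable.
Qed.

Lemma cLfun2_random_cvec n (Z : T -> 'cV[R[i]]_n) :
  (forall i, cLfun2 (fun w => Z w i 0)) -> random_cvec Z.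
Proof. by move=> LZ i; split; apply: Lfun2_measurable; [exact: (LZ i).1|exact: (LZ i).2]. Qed.

Lemma expectation_cnorm2_sqr n (Z : T -> 'cV[R[i]]_n) :
  (forall i, cLfun2 (fun w => Z w i 0)) ->
  'E_Pr[fun w => (cnorm2 (Z w) ^+ 2)%R]%E = (\sum_i \int[Pr]_w sqn (Z w i 0))%:E.
Proof.
move=> LZ; have iZ i : L1 (fun w => sqn (Z w i 0)) by exact: integrable_sqn.
rewrite unlock -Rintegral_sum// EFin_Rintegral; last exact: integrable_sum_EFin.
apply: eq_integral => w _; rewrite sqr_sqrtr; last by apply: sumr_ge0 => i _; exact: sqr_ge0.
congr EFin; apply: eq_bigr => i _; rewrite sqnE.
by case: (Z w i 0) => p q /=; rewrite sqr_sqrtr// addr_ge0 ?sqr_ge0.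
Qed.

Lemma integral_sqn_orthogonal (Z W : T -> R[i]) (a : R) :
  cLfun2 Z -> cLfun2 W -> \int[Pr]_w cdot (Z w) (W w) = 0 ->
  \int[Pr]_w sqn (Z w + a%:C * W w) =
  \int[Pr]_w sqn (Z w) + a ^+ 2 * \int[Pr]_w sqn (W w).
Proof.
move=> lZ lW o; have iZ := integrable_sqn lZ; have iW := integrable_sqn lW.
have iZW := integrable_cdot lZ lW.
rewrite (eq_Rintegral Pr (g := fun w => sqn (Z w) + 2 * a * cdot (Z w) (W w)
  + a ^+ 2 * sqn (W w))) => [|w _]; last exact: sqn_addZ.
have iZWa : L1 (fun w => 2 * a * cdot (Z w) (W w)) by exact: integrableZ_EFin.
rewrite RintegralD//; [|exact: integrableD_EFin|exact: integrableZ_EFin].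
by rewrite RintegralD// !RintegralZl// o mulr0 addr0.
Qed.

Lemma integral_lincomb_orthogonal p q (X : T -> 'cV[R]_p) (N : T -> 'cV[R]_q)
    (al : 'I_p -> R) (be : 'I_q -> R) (c : R) :
  (forall k, L2 (fun w => X w k 0)) -> (forall l, L2 (fun w => N w l 0)) ->
  (forall k l, \int[Pr]_w (N w l 0 * X w k 0) = 0) ->
  (forall l, \int[Pr]_w N w l 0 = 0) ->
  \int[Pr]_w ((\sum_k al k * X w k 0 + c) * \sum_l be l * N w l 0) = 0.
Proof.
move=> LX LN XN N0.
rewrite (eq_Rintegral Pr (g := fun w => \sum_l
    (be l * (\sum_k al k * (N w l 0 * X w k 0) + c * N w l 0)))) => [|w _]; last first.
  rewrite mulr_sumr; apply: eq_bigr => l _.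
  rewrite mulrCA; congr (_ * _); rewrite mulrDl mulr_suml; congr (_ + _).
  by apply: eq_bigr => k _; rewrite -mulrA [X w k 0 * _]mulrC.
have i1 k l : L1 (fun w => N w l 0 * X w k 0) by exact: Lfun2M_integrable.
have i1Z k l : L1 (fun w => al k * (N w l 0 * X w k 0)) by exact: integrableZ_EFin.
have i2 l : L1 (fun w => c * N w l 0).
  by apply: integrableZ_EFin; exact: Lfun2_integrable.
have i3 l : L1 (fun w => \sum_k al k * (N w l 0 * X w k 0) + c * N w l 0).
  by apply: integrableD_EFin => //; exact: integrable_sum_EFin.
rewrite Rintegral_sum => [|l]; last exact: integrableZ_EFin.
rewrite big1// => l _; rewrite RintegralZl// RintegralD//; last first.
  exact: integrable_sum_EFin.
rewrite Rintegral_sum// RintegralZl ?N0 ?mulr0 ?addr0//; last exact: Lfun2_integrable.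
by rewrite big1 ?mulr0// => k _; rewrite RintegralZl// XN mulr0.
Qed.

(** X and N are real, so real and imaginary parts are real combinations of their entries. The
    constant [c] accommodates the shift by the equilibrium. *)
Lemma integral_cdot_orthogonal p q s (X : T -> 'cV[R]_p) (N : T -> 'cV[R]_q)
    (A : 'M[R[i]]_(s, p)) (B : 'M[R[i]]_(s, q)) (c : 'cV[R[i]]_s) i :
  (forall k, L2 (fun w => X w k 0)) -> (forall l, L2 (fun w => N w l 0)) ->
  (forall k l, \int[Pr]_w (N w l 0 * X w k 0) = 0) ->
  (forall l, \int[Pr]_w N w l 0 = 0) ->
  \int[Pr]_w cdot ((A *m cplx_mx (X w) + c) i 0) ((B *m cplx_mx (N w)) i 0) = 0.
Proof.
move=> LX LN XN N0.
have reE t (M : 'M[R[i]]_(s, t)) (Y : T -> 'cV[R]_t) w :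
    complex.Re ((M *m cplx_mx (Y w)) i 0) = \sum_k complex.Re (M i k) * Y w k 0.
  by rewrite mxE complex_Re_sum; apply: eq_bigr => k _; rewrite complex_ReM mxE /= mulr0 subr0.
have imE t (M : 'M[R[i]]_(s, t)) (Y : T -> 'cV[R]_t) w :
    complex.Im ((M *m cplx_mx (Y w)) i 0) = \sum_k complex.Im (M i k) * Y w k 0.
  by rewrite mxE complex_Im_sum; apply: eq_bigr => k _; rewrite complex_ImM mxE /= mulr0 add0r.
have lin t (Y : T -> 'cV[R]_t) (be : 'I_t -> R) : (forall k, L2 (fun w => Y w k 0)) ->
    L2 (fun w => \sum_k be k * Y w k 0).
  by move=> LY; apply: Lfun2_sum => k; exact: Lfun2Z.
rewrite (eq_Rintegral Pr (g := fun w =>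
  (\sum_k complex.Re (A i k) * X w k 0 + complex.Re (c i 0)) *
    (\sum_l complex.Re (B i l) * N w l 0) +
  (\sum_k complex.Im (A i k) * X w k 0 + complex.Im (c i 0)) *
    (\sum_l complex.Im (B i l) * N w l 0))) => [|w _]; last first.
  by rewrite /cdot mxE complex_ReD complex_ImD !reE !imE.
rewrite RintegralD//; last 2 first.
- by apply: Lfun2M_integrable; [apply: Lfun2D; [exact: lin|exact: Lfun2_cst]|exact: lin].
- by apply: Lfun2M_integrable; [apply: Lfun2D; [exact: lin|exact: Lfun2_cst]|exact: lin].
by rewrite !integral_lincomb_orthogonal// addr0.
Qed.

End ComplexSquareIntegrable.

(** * The recursion in Jordan coordinates and its mean-square limit *)

Section StochasticRecursion.
Context d (T : measurableType d) (R : realType) (Pr : probability T R) (r m : nat).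
(* [sg] is the sign of the gains: 1 under (A2) and -1 under (A2'). *)
Context (a : nat -> R) (sg beta : R) (x N : nat -> T -> 'cV[R]_(r + m)).
Context (P : 'M[R]_(r + m)) (u : 'cV[R]_(r + m)).
Context (H : 'M[R[i]]_(r + m)) (Dl : 'M[R[i]]_m).

Local Notation L1 f := (Pr.-integrable [set: T] (EFin \o f)).
Local Notation L2 f := (f \in Lfun Pr 2%:E).

Hypothesis Lx : forall s k, L2 (fun w => x s w k 0).
Hypothesis LN : forall s k, L2 (fun w => N s w k 0).
Hypothesis orthN : forall s t i k, (t <= s)%N ->
  \int[Pr]_w (N s w i 0 * x t w k 0) = 0.
Hypothesis meanN : forall s i, \int[Pr]_w N s w i 0 = 0.
Hypothesis N_le : exists2 K : R, 0 <= K & forall s i,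
  \int[Pr]_w (N s w i 0 ^+ 2) <= K * (1 + \sum_j \int[Pr]_w (x s w j 0 ^+ 2)).
Hypothesis x_rec : forall s w,
  x s.+1 w = x s w + a s *: ((P - 1%:M) *m x s w + u) + a s *: N s w.
Hypothesis a_sg : forall s, a s = sg * `|a s|.
Hypothesis a_dvg : forall M : R, exists n, M <= \sum_(0 <= k < n) `|a k|.
Hypothesis a_sqr : cvgn (series (fun k => a k ^+ 2)).
Hypothesis uH : H \in unitmx.
Hypothesis HP : H *m cplx_mx P = block_mx 1%:M 0 0 Dl *m H.
Hypothesis Hu0 : usubmx (H *m cplx_mx u) = 0.
Hypothesis uDl : (1%:M - Dl) \in unitmx.
Hypothesis Dl_upper : forall i j : 'I_m, (j < i)%N -> Dl i j = 0.
Hypothesis beta0 : 0 < beta.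
Hypothesis Dl_gap : forall i, sg * (complex.Re (Dl i i) - 1) <= - beta.

(** The equilibrium of the averaged recursion in the last m coordinates; centring [low] there makes
    its drift linear. *)
Definition rest_limit : 'cV[R[i]]_m := invmx (1%:M - Dl) *m dsubmx (H *m cplx_mx u).

Let y s w : 'cV[R[i]]_(r + m) := H *m cplx_mx (x s w).
Let up s w : 'cV[R[i]]_r := usubmx (y s w).
Let low s w : 'cV[R[i]]_m := dsubmx (y s w) - rest_limit.
Let eta s w : 'cV[R[i]]_(r + m) := H *m cplx_mx (N s w).

Let y_rec s w : y s.+1 w = y s w +
  (a s)%:C *: ((block_mx 1%:M 0 0 Dl - 1%:M) *m y s w + H *m cplx_mx u) +
  (a s)%:C *: eta s w.
Proof.
rewrite /y x_rec /cplx_mx !map_mxD !map_mxZ -!/(cplx_mx _) !mulmxDr -!scalemxAr.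
congr (_ + _ *: _ + _).
rewrite /cplx_mx map_mxD mulmxDr.
congr (_ + _).
rewrite map_mxM map_mxB map_mx1 -!/(cplx_mx _).
by rewrite !mulmxA mulmxBr mulmx1 HP !mulmxBl mul1mx.
Qed.

Let mul_rest (v : 'cV[R[i]]_(r + m)) :
  (block_mx 1%:M 0 0 Dl - 1%:M) *m v = col_mx 0 ((Dl - 1%:M) *m dsubmx v).
Proof.
rewrite -{1}(vsubmxK v) mulmxBl mul1mx mul_block_col !mul0mx mul1mx addr0 add0r.
by rewrite opp_col_mx add_col_mx subrr mulmxBl mul1mx.
Qed.

Let up_rec s w : up s.+1 w = up s w + (a s)%:C *: usubmx (eta s w).
Proof.
rewrite /up y_rec !linearD /= !linearZ /= Hu0 scaler0 addr0.
by rewrite mul_rest col_mxKu scaler0 addr0.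
Qed.

Let low_rec s w : low s.+1 w =
  (low s w + (a s)%:C *: ((Dl - 1%:M) *m low s w)) + (a s)%:C *: dsubmx (eta s w).
Proof.
rewrite /low y_rec !linearD /= !linearZ /= -scalerDr.
rewrite mul_rest col_mxKd.
have -> : dsubmx (H *m cplx_mx u) = (1%:M - Dl) *m rest_limit.
  by rewrite /rest_limit mulmxA mulmxV// mul1mx.
have -> : (1%:M - Dl) *m rest_limit = (Dl - 1%:M) *m - rest_limit.
  by rewrite mulmxN -mulNmx opprB.
by rewrite scalerDr addrAC; congr (_ + _); rewrite addrAC.
Qed.

Let Ly s k : cLfun2 Pr (fun w => y s w k 0).
Proof.
by apply: cLfun2_mulmx => j; under eq_fun do rewrite mxE; exact: cLfun2_real.
Qed.

Let Leta s k : cLfun2 Pr (fun w => eta s w k 0).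
Proof.
by apply: cLfun2_mulmx => j; under eq_fun do rewrite mxE; exact: cLfun2_real.
Qed.

Let Lup s k : cLfun2 Pr (fun w => up s w k 0).
Proof. by under eq_fun do rewrite mxE; exact: Ly. Qed.

Let Llow s k : cLfun2 Pr (fun w => low s w k 0).
Proof.
under eq_fun do rewrite mxE [X in X + _]mxE; apply: cLfun2D; first exact: Ly.
exact: cLfun2_cst.
Qed.

Let e (Z : T -> R[i]) : R := \int[Pr]_w sqn (Z w).

Let e_mulmx_le p q (A : 'M[R[i]]_(p, q)) : exists2 K : R, 0 <= K &
  forall Z : T -> 'cV[R[i]]_q, (forall j, cLfun2 Pr (fun w => Z w j 0)) ->
  \sum_i e (fun w => (A *m Z w) i 0) <= K * \sum_j e (fun w => Z w j 0).
Proof.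
have [K K0 KP] := sqn_mulmx_le A; exists K => // Z LZ.
have iZ j : L1 (fun w => sqn (Z w j 0)) by exact: integrable_sqn.
have iAZ i : L1 (fun w => sqn ((A *m Z w) i 0)).
  by apply: integrable_sqn; exact: cLfun2_mulmx.
rewrite /e -!Rintegral_sum// -RintegralZl//; last exact: integrable_sum_EFin.
apply: le_Rintegral => //; first exact: integrable_sum_EFin.
by apply: integrableZ_EFin; exact: integrable_sum_EFin.
Qed.

Let e_real (X : T -> R) : e (fun w => (X w)%:C) = \int[Pr]_w (X w ^+ 2).
Proof. by apply: eq_Rintegral => w _; rewrite sqnE /= expr0n addr0. Qed.

Let energy s : R := \sum_i e (fun w => up s w i 0) + \sum_i e (fun w => low s w i 0).

Let energy_ge0 s : 0 <= energy s.
Proof. by rewrite addr_ge0// sumr_ge0// => i _; exact: integral_sqn_ge0. Qed.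

(** The noise bound is stated for x. It is transported through x = H^-1 y, where the last
    coordinates of y are [low] plus the equilibrium; S is the contribution of the latter. *)
Let e_eta_le : exists2 K : R, 0 <= K & forall s,
  \sum_i e (fun w => eta s w i 0) <= K * (1 + energy s).
Proof.
have [K1 K10 K1P] := N_le; have [K2 K20 K2P] := e_mulmx_le H.
have [K3 K30 K3P] := e_mulmx_le (invmx H).
pose S := \sum_i sqn (rest_limit i 0).
have S0 : 0 <= S by apply: sumr_ge0 => i _; exact: sqn_ge0.
pose n : R := (r + m)%:R.
have n0 : 0 <= n by [].
have x_le s : \sum_j \int[Pr]_w (x s w j 0 ^+ 2) <= K3 * (2 * energy s + 2 * S).
  rewrite (eq_bigr (fun j => e (fun w => (invmx H *m y s w) j 0))) => [|j _]; last first.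
    by rewrite -e_real; apply: eq_Rintegral => w _; rewrite /y mulKmx// mxE.
  apply: (le_trans (K3P _ (Ly s))); rewrite ler_wpM2l// big_split_ord /=.
  rewrite /energy mulrDr -addrA lerD//.
    rewrite (eq_bigr (fun i => e (fun w => up s w i 0))) => [|i _]; last first.
      by apply: eq_Rintegral => w _; rewrite [in RHS]mxE.
    by rewrite ler_peMl ?ler1n// sumr_ge0// => i _; exact: integral_sqn_ge0.
  rewrite !mulr_sumr -big_split; apply: ler_sum => i _ /=.
  rewrite -(Rintegral_cst_probability Pr (2 * sqn (rest_limit i 0))).
  have iL : L1 (fun w => sqn (low s w i 0)) by exact: integrable_sqn.
  have ic (c : R) : L1 (fun=> c) by apply/Lfun2_integrable/Lfun2_cst.
  rewrite -RintegralZl// -RintegralD//; last exact: integrableZ_EFin.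
  apply: le_Rintegral => //; first by apply: integrable_sqn.
    by apply: integrableD_EFin => //; exact: integrableZ_EFin.
  move=> w _; rewrite (_ : y s w (rshift r i) 0 = low s w i 0 + rest_limit i 0).
    exact: sqnD_le.
  by rewrite !mxE subrK.
(* Uses 1 + K3 (2E + 2S) <= (1 + 2 K3 + 2 K3 S)(1 + E) with E the energy. *)
exists (K2 * (n * (K1 * (1 + 2 * K3 + 2 * K3 * S)))) => [|s].
  by rewrite !mulr_ge0// !addr_ge0// !mulr_ge0.
have LNc j : cLfun2 Pr (fun w => cplx_mx (N s w) j 0).
  by under eq_fun do rewrite mxE; exact: cLfun2_real.
apply: (le_trans (K2P _ LNc)); rewrite -!mulrA ler_wpM2l//.
apply: (@le_trans _ _ (\sum_(i < r + m) (K1 * (1 + K3 * (2 * energy s + 2 * S))))).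
  apply: ler_sum => i _.
  rewrite (_ : e _ = \int[Pr]_w (N s w i 0 ^+ 2)); last first.
    by rewrite -e_real; apply: eq_Rintegral => w _; rewrite mxE.
  by apply: (le_trans (K1P s i)); rewrite ler_wpM2l// lerD2l.
rewrite sumr_const card_ord -[leLHS]mulr_natl ler_wpM2l// ler_wpM2l//.
move: (energy s) (energy_ge0 s) => E E0.
rewrite -subr_ge0 (_ : _ - _ = 2 * K3 + E + 2 * K3 * S * E); last by ring.
by rewrite addr_ge0 ?addr_ge0 ?mulr_ge0// ?mulr_ge0.
Qed.

(** Here the noise at time s is tested against a state at an earlier time t, which calls for means
    conditioned on the whole history. *)
Let up_orthogonal s t i : (t <= s)%N ->
  \int[Pr]_w cdot (up s w i 0 - up t w i 0) (usubmx (eta s w) i 0) = 0.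
Proof.
move=> ts; rewrite -[RHS](@integral_cdot_orthogonal _ _ _ Pr _ _ _
  (fun w => x s w - x t w) (N s) (usubmx H) (usubmx H) 0 i).
- apply: eq_Rintegral => w _; rewrite /up /eta /y -!mul_usub_mx addr0; congr cdot.
  by rewrite /cplx_mx map_mxB mulmxBr !mxE.
- by move=> k; under eq_fun do rewrite !mxE; exact: Lfun2B.
- exact: LN.
- move=> k l; rewrite (eq_Rintegral Pr (g := fun w =>
    N s w l 0 * x s w k 0 - N s w l 0 * x t w k 0)) => [|w _]; last first.
    by rewrite !mxE mulrBr.
  by rewrite RintegralB//; [rewrite !orthN ?subr0|exact: Lfun2M_integrable..].
- exact: meanN.
Qed.

Let Lusub_eta s i : cLfun2 Pr (fun w => usubmx (eta s w) i 0).
Proof. by under eq_fun do rewrite mxE; exact: Leta. Qed.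

Let Ldsub_eta s i : cLfun2 Pr (fun w => dsubmx (eta s w) i 0).
Proof. by under eq_fun do rewrite mxE; exact: Leta. Qed.

Let eta_split s : \sum_i e (fun w => eta s w i 0) =
  \sum_i e (fun w => usubmx (eta s w) i 0) + \sum_i e (fun w => dsubmx (eta s w) i 0).
Proof.
rewrite big_split_ord /=; congr (_ + _); apply: eq_bigr => i _;
  by apply: eq_Rintegral => w _; rewrite [in RHS]mxE.
Qed.

Let up_increment_step s t i : (s <= t)%N ->
  e (fun w => up t.+1 w i 0 - up s w i 0) =
  e (fun w => up t w i 0 - up s w i 0) + a t ^+ 2 * e (fun w => usubmx (eta t w) i 0).
Proof.
move=> st; rewrite /e -integral_sqn_orthogonal//.
- apply: eq_Rintegral => w _; rewrite up_rec mxE [X in _ + X - _]mxE addrAC.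
  by [].
- apply: cLfun2D => //; under eq_fun do rewrite -mulN1r; exact: cLfun2Z.
- exact: up_orthogonal.
Qed.

Let up_step s : \sum_i e (fun w => up s.+1 w i 0) =
  \sum_i e (fun w => up s w i 0) + a s ^+ 2 * \sum_i e (fun w => usubmx (eta s w) i 0).
Proof.
rewrite mulr_sumr -big_split; apply: eq_bigr => i _ /=.
rewrite /e -integral_sqn_orthogonal//.
  by apply: eq_Rintegral => w _; rewrite up_rec mxE [X in _ + X]mxE.
rewrite -[RHS](@integral_cdot_orthogonal _ _ _ Pr _ _ _
  (x s) (N s) (usubmx H) (usubmx H) 0 i)//; last by move=> k l; exact: orthN.
by apply: eq_Rintegral => w _; rewrite /up /eta /y -!mul_usub_mx addr0.
Qed.

(** In the expansion of the square, the first-order term is 2|a| times the form controlled by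
    [triangular_lyapunov], at most -beta |a| V. The second-order term and the noise, free of cross
    terms by orthogonality, form the error; it involves the full energy because the noise depends on
    all coordinates. *)
Let low_step : exists2 wt : 'I_m -> R, (forall i, 1 <= wt i) &
  exists2 K : R, 0 <= K & forall s,
    \sum_i wt i * e (fun w => low s.+1 w i 0) <=
    (1 - beta * `|a s|) * (\sum_i wt i * e (fun w => low s w i 0)) +
    K * a s ^+ 2 * (1 + energy s).
Proof.
(* Since a = sg |a|, the drift is |a| [B], and [B] has diagonal real parts at most -beta for either
   sign of the gains. *)
pose B : 'M[R[i]]_m := sg%:C *: (Dl - 1%:M).
have Bup (i j : 'I_m) : (j < i)%N -> B i j = 0.
  move=> ji; rewrite !mxE Dl_upper// -val_eqE gtn_eqF//.
  by rewrite subr0 mulr0.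
have Bdiag i : complex.Re (B i i) <= - beta.
  apply: le_trans (Dl_gap i); rewrite !mxE eqxx complex_ReM /= mul0r subr0.
  by rewrite complex_ReD /=.
have [wt wt1 lyap] := triangular_lyapunov beta0 Bup Bdiag.
exists wt => //.
have wt0 i : 0 <= wt i by rewrite (le_trans ler01).
have [K1 K10 K1P] := sqn_mulmx_le (Dl - 1%:M).
have [K2 K20 K2P] := e_eta_le.
(* The total weight dominates each [wt i]; it serves to pass from weighted to unweighted sums. *)
pose W := \sum_i wt i.
have W0 : 0 <= W by exact: sumr_ge0.
have wtW i : wt i <= W by rewrite /W (bigD1 i)//= lerDl sumr_ge0.
exists (W * K1 + W * K2) => [|s]; first by rewrite addr_ge0// mulr_ge0.
have arith1 (V L Q Z t A : R) :
    2 * t * L <= 2 * t * (- (beta / 2) * V) -> A ^+ 2 * Q <= A ^+ 2 * (W * (K1 * Z)) ->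
    V + 2 * t * L + A ^+ 2 * Q <= (1 - beta * t) * V + W * K1 * A ^+ 2 * Z.
  by move=> h1 h2; lra.
have arith2 (A V Z Q a2 t E : R) : A <= (1 - t) * V + W * K1 * a2 * Z ->
    a2 * Q <= a2 * (W * (K2 * E)) -> W * K1 * a2 * Z <= W * K1 * a2 * E ->
    A + a2 * Q <= (1 - t) * V + (W * K1 + W * K2) * a2 * E.
  by move=> h1 h2 h3; lra.
pose v w := low s w + (a s)%:C *: ((Dl - 1%:M) *m low s w).
have Lv i : cLfun2 Pr (fun w => v w i 0).
  under eq_fun do rewrite mxE [X in _ + X]mxE; apply: cLfun2D => //.
  by apply: cLfun2Z; exact: cLfun2_mulmx.
have stepi i : e (fun w => low s.+1 w i 0) =
    e (fun w => v w i 0) + a s ^+ 2 * e (fun w => dsubmx (eta s w) i 0).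
  rewrite /e -integral_sqn_orthogonal//.
    by apply: eq_Rintegral => w _; rewrite low_rec mxE [X in _ + X]mxE.
  (* The vector [v] is [M] applied to [low], hence an affine image of x(s), to which the noise is
     orthogonal. *)
  pose M := 1%:M + (a s)%:C *: (Dl - 1%:M).
  rewrite -[RHS](@integral_cdot_orthogonal _ _ _ Pr _ _ _
    (x s) (N s) (M *m dsubmx H) (dsubmx H) (M *m - rest_limit) i)//; last first.
    by move=> k l; exact: orthN.
  apply: eq_Rintegral => w _; rewrite /v /low /eta /y -!mul_dsub_mx; congr cdot.
  by rewrite -mulmxA -mulmxDr [in RHS]mulmxDl mul1mx -scalemxAl.
have pointwise w : \sum_i wt i * sqn (v w i 0) <=
    (1 - beta * `|a s|) * (\sum_i wt i * sqn (low s w i 0)) +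
    W * K1 * a s ^+ 2 * \sum_i sqn (low s w i 0).
  set z := low s w.
  have vE i : v w i 0 = z i 0 + (a s)%:C * ((Dl - 1%:M) *m z) i 0.
    by rewrite mxE [X in _ + X]mxE.
  have sgE i : a s * cdot (z i 0) (((Dl - 1%:M) *m z) i 0) =
      `|a s| * cdot (z i 0) ((B *m z) i 0).
    have -> : (B *m z) i 0 = sg%:C * ((Dl - 1%:M) *m z) i 0.
      by rewrite /B -scalemxAl mxE.
    rewrite {1}a_sg /cdot complex_ReM complex_ImM /=; ring.
  rewrite [leLHS](eq_bigr (fun i => wt i * sqn (z i 0) +
     2 * `|a s| * (wt i * cdot (z i 0) ((B *m z) i 0)) +
     a s ^+ 2 * (wt i * sqn (((Dl - 1%:M) *m z) i 0)))) => [|i _]; last first.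
    rewrite vE sqn_addZ -[2 * a s * _]mulrA sgE; ring.
  rewrite big_split /= [X in X + _ <= _]big_split /= -!mulr_sumr.
  have := ler_wpM2l (_ : 0 <= 2 * `|a s|) (lyap z) => /(_ (mulr_ge0 _ _)) l1.
  have l2 : \sum_i wt i * sqn (((Dl - 1%:M) *m z) i 0) <= W * (K1 * \sum_i sqn (z i 0)).
    apply: (@le_trans _ _ (\sum_i W * sqn (((Dl - 1%:M) *m z) i 0))).
      by apply: ler_sum => i _; rewrite ler_wpM2r ?sqn_ge0.
    by rewrite -mulr_sumr ler_wpM2l.
  have {}l2 := ler_wpM2l (sqr_ge0 (a s)) l2.
  have {}l1 := l1 (ler0n _ 2) (normr_ge0 _).
  exact: arith1 l1 l2.
have isq i : L1 (fun w => sqn (low s w i 0)) by exact: integrable_sqn.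
have isv i : L1 (fun w => sqn (v w i 0)) by exact: integrable_sqn.
have isqw i : L1 (fun w => wt i * sqn (low s w i 0)) by exact: integrableZ_EFin.
have isvw i : L1 (fun w => wt i * sqn (v w i 0)) by exact: integrableZ_EFin.
have mid : \sum_i wt i * e (fun w => v w i 0) <=
    (1 - beta * `|a s|) * (\sum_i wt i * e (fun w => low s w i 0)) +
    W * K1 * a s ^+ 2 * \sum_i e (fun w => low s w i 0).
  rewrite [leLHS](eq_bigr (fun i => \int[Pr]_w (wt i * sqn (v w i 0)))) => [|i _]; last first.
    by rewrite RintegralZl.
  rewrite [X in _ <= _ * X + _](eq_bigr (fun i => \int[Pr]_w (wt i * sqn (low s w i 0))))
    => [|i _]; last by rewrite RintegralZl.
  rewrite /e -!Rintegral_sum// -!RintegralZl//; try exact: integrable_sum_EFin.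
  rewrite -RintegralD//; try (apply: integrableZ_EFin; exact: integrable_sum_EFin).
  apply: le_Rintegral => //; first exact: integrable_sum_EFin.
  by apply: integrableD_EFin; apply: integrableZ_EFin; exact: integrable_sum_EFin.
rewrite [leLHS](eq_bigr (fun i => wt i * e (fun w => v w i 0) +
   a s ^+ 2 * (wt i * e (fun w => dsubmx (eta s w) i 0)))) => [|i _]; last first.
  by rewrite stepi mulrDr [wt i * (_ * _)]mulrCA.
rewrite [leLHS]big_split /= -[X in _ + X <= _]mulr_sumr.
have noise_le : \sum_i wt i * e (fun w => dsubmx (eta s w) i 0) <=
    W * (K2 * (1 + energy s)).
  apply: (@le_trans _ _ (\sum_i W * e (fun w => dsubmx (eta s w) i 0))).
    by apply: ler_sum => i _; rewrite ler_wpM2r ?integral_sqn_ge0.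
  rewrite -mulr_sumr ler_wpM2l//; apply: le_trans (K2P s); rewrite eta_split.
  by rewrite lerDr sumr_ge0// => i _; exact: integral_sqn_ge0.
have {}noise_le := ler_wpM2l (sqr_ge0 (a s)) noise_le.
have low_le : \sum_i e (fun w => low s w i 0) <= 1 + energy s.
  rewrite /energy addrA lerDr addr_ge0// sumr_ge0// => i _; exact: integral_sqn_ge0.
have WKa : 0 <= W * K1 * a s ^+ 2 by rewrite mulr_ge0 ?sqr_ge0// mulr_ge0.
have {}low_le := ler_wpM2l WKa low_le.
exact: arith2 mid noise_le low_le.
Qed.

(** Replacing the lower energy by its weighted form V gives F with energy <= F, as the weights are
    at least 1. Dropping the contraction leaves a Gronwall recursion for F driven by a^2. *)
Let energy_bounded : exists M, forall s, energy s <= M.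
Proof.
have arith (K K2 S V V' Q t a2 E F : R) : a2 * Q <= a2 * (K2 * (1 + F)) ->
    K * a2 * (1 + E) <= K * a2 * (1 + F) -> 0 <= t * V ->
    V' <= (1 - t) * V + K * a2 * (1 + E) -> F = S + V ->
    S + a2 * Q + V' <= (1 + (K + K2) * a2) * F + (K + K2) * a2.
  by move=> g1 g2 g3 g4 g5; lra.
have [wt wt1 [K K0 KP]] := low_step; have [K2 K20 K2P] := e_eta_le.
have wt0 i : 0 <= wt i by rewrite (le_trans ler01).
pose V s := \sum_i wt i * e (fun w => low s w i 0).
pose F s := \sum_i e (fun w => up s w i 0) + V s.
have e0 Z : 0 <= e Z by exact: integral_sqn_ge0.
have V0 s : 0 <= V s by apply: sumr_ge0 => i _; rewrite mulr_ge0.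
have leF s : energy s <= F s.
  rewrite /energy /F lerD2l; apply: ler_sum => i _.
  by rewrite -[leLHS]mul1r ler_wpM2r.
have FS s : F s.+1 <= (1 + (K + K2) * a s ^+ 2) * F s + (K + K2) * a s ^+ 2.
  have a2 := sqr_ge0 (a s).
  have h1 : a s ^+ 2 * \sum_i e (fun w => usubmx (eta s w) i 0) <=
      a s ^+ 2 * (K2 * (1 + F s)).
    rewrite ler_wpM2l//; apply: (@le_trans _ _ (K2 * (1 + energy s))).
      by apply: le_trans (K2P s); rewrite eta_split lerDl sumr_ge0.
    by rewrite ler_wpM2l// lerD2l.
  have h2 : K * a s ^+ 2 * (1 + energy s) <= K * a s ^+ 2 * (1 + F s).
    by apply: ler_wpM2l; [exact: mulr_ge0|rewrite lerD2l].
  have h3 : 0 <= beta * `|a s| * V s by rewrite !mulr_ge0// ltW.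
  have h4 : V s.+1 <= (1 - beta * `|a s|) * V s + K * a s ^+ 2 * (1 + energy s) := KP s.
  have FE : F s = \sum_i e (fun w => up s w i 0) + V s by [].
  rewrite [leLHS]/F up_step; exact: arith h1 h2 h3 h4 FE.
have [M MP] := growth_bounded (addr_ge0 K0 K20) (fun k => sqr_ge0 (a k)) a_sqr FS.
by exists M => s; exact: le_trans (leF s) (MP s).
Qed.

Let eta_bounded : exists2 K : R, 0 <= K & forall s i, e (fun w => eta s w i 0) <= K.
Proof.
have [M MP] := energy_bounded; have [K K0 KP] := e_eta_le.
exists (K * (1 + M)) => [|s i].
  by rewrite mulr_ge0// addr_ge0// (le_trans (energy_ge0 0%N)).
apply: (@le_trans _ _ (\sum_i e (fun w => eta s w i 0))).
  by rewrite (bigD1 i)//= lerDl sumr_ge0// => j _; exact: integral_sqn_ge0.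
by apply: (le_trans (KP s)); rewrite ler_wpM2l// lerD2l.
Qed.

(** Once the energy is at most M, the error in [low_step] is K (1 + M) a^2, which is summable. *)
Let low_cvg (eps : R) : 0 < eps -> exists n, forall s, (n <= s)%N ->
  \sum_i e (fun w => low s w i 0) <= eps.
Proof.
move=> eps0; have [wt wt1 [K K0 KP]] := low_step.
have [M MP] := energy_bounded.
have M0 : 0 <= M by exact: le_trans (energy_ge0 0%N) (MP 0%N).
have wt0 i : 0 <= wt i by rewrite (le_trans ler01).
have e0 Z : 0 <= e Z by exact: integral_sqn_ge0.
have v0 s : 0 <= \sum_i wt i * e (fun w => low s w i 0).
  by apply: sumr_ge0 => i _; rewrite mulr_ge0.
have c0 k : 0 <= K * (1 + M) * a k ^+ 2.
  by rewrite mulr_ge0 ?sqr_ge0// mulr_ge0// addr_ge0.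
have cc : cvgn (series (fun k => K * (1 + M) * a k ^+ 2)).
  exact: (@is_cvg_seriesZ R (fun k => a k ^+ 2) (K * (1 + M)) a_sqr).
have vS s : \sum_i wt i * e (fun w => low s.+1 w i 0) <=
    (1 - beta * `|a s|) * (\sum_i wt i * e (fun w => low s w i 0)) +
    K * (1 + M) * a s ^+ 2.
  apply: (le_trans (KP s)); rewrite lerD2l mulrAC ler_wpM2r ?sqr_ge0//.
  by apply: ler_wpM2l => //; rewrite lerD2l.
have [n nP] := contraction_cvg0 beta0 v0 (fun k => normr_ge0 (a k)) a_dvg c0 cc vS eps0.
exists n => s ns; apply: le_trans (nP s ns); apply: ler_sum => i _.
by rewrite -[leLHS]mul1r ler_wpM2r.
Qed.

Let up_cauchy i (eps : R) : 0 < eps -> exists n, forall s t, (n <= s)%N -> (n <= t)%N ->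
  e (fun w => up t w i 0 - up s w i 0) <= eps.
Proof.
move=> eps0; have [K K0 KP] := eta_bounded.
have inc s t : (s <= t)%N ->
    e (fun w => up t w i 0 - up s w i 0) <= K * \sum_(s <= k < t) a k ^+ 2.
  move=> /subnKC <-; elim: (t - s)%N => [|k IH].
    rewrite addn0 big_geq// mulr0 (_ : e _ = 0)//.
    rewrite -[RHS](Rintegral_cst_probability Pr); apply: eq_Rintegral => w _.
    by rewrite subrr /sqn /cdot /= mulr0 addr0.
  rewrite addnS up_increment_step ?leq_addr// big_nat_recr ?leq_addr//= mulrDr.
  rewrite lerD// mulrC ler_wpM2r ?sqr_ge0//.
  apply: le_trans (KP (s + k)%N (lshift m i)).
  by rewrite (_ : (fun w => usubmx _ i 0) = fun w => eta (s + k) w (lshift m i) 0)//;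
    apply/funext => w; rewrite [LHS]mxE.
(* Dividing by K + 1 avoids a case distinction when K = 0. *)
have [n nP] := @cvg_series_tail R (fun k => a k ^+ 2) a_sqr (eps / (K + 1))
  (divr_gt0 eps0 (ltr_wpDl K0 ltr01)).
have wlg s t : (n <= s)%N -> (s <= t)%N ->
    e (fun w => up t w i 0 - up s w i 0) <= eps.
  move=> ns st; apply: (le_trans (inc s t st)).
  apply: (@le_trans _ _ (K * (eps / (K + 1)))).
    by rewrite ler_wpM2l// nP// (leq_trans ns).
  rewrite mulrA ler_pdivrMr ?(ltr_wpDl K0 ltr01)// mulrDr mulr1 mulrC.
  by rewrite lerDl ltW.
exists n => s t ns nt; have [st|/ltnW ts] := leqP s t; first exact: wlg.
rewrite (_ : e _ = e (fun w => up s w i 0 - up t w i 0)); first exact: wlg.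
apply: eq_Rintegral => w _; rewrite -[in LHS]opprB /sqn /cdot.
by case: (_ - _) => p q /=; rewrite !mulrNN.
Qed.

Let LupB s t i : cLfun2 Pr (fun w => up t w i 0 - up s w i 0).
Proof.
by apply: cLfun2D => //; under eq_fun do rewrite -mulN1r; exact: cLfun2Z.
Qed.

Let up_limit_exists : exists L : T -> 'cV[R[i]]_r,
  (forall i, cLfun2 Pr (fun w => L w i 0)) /\
  forall i (eps : R), 0 < eps -> exists n, forall s, (n <= s)%N ->
    e (fun w => up s w i 0 - L w i 0) <= eps.
Proof.
have /choice[f fP] i : exists g : T -> R[i], cLfun2 Pr g /\
    forall eps : R, 0 < eps -> exists n, forall s, (n <= s)%N ->
    e (fun w => up s w i 0 - g w) <= eps.
  have [g g2 gP] : exists2 g, L2 g & forall eps : R, 0 < eps -> exists n,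
      forall s, (n <= s)%N -> \int[Pr]_w ((complex.Re (up s w i 0) - g w) ^+ 2) <= eps.
    apply: Lfun2_complete => [s|eps eps0]; first exact: (Lup s i).1.
    have [n nP] := up_cauchy i eps0; exists n => s t ns nt.
    apply: le_trans (nP s t ns nt); rewrite /e integral_sqnE//.
    rewrite (_ : \int[Pr]_w _ = \int[Pr]_w (complex.Re (up t w i 0 - up s w i 0) ^+ 2)).
      by rewrite lerDl; apply: Rintegral_ge0 => w _; exact: sqr_ge0.
    by apply: eq_Rintegral => w _; rewrite complex_ReB.
  have [h h2 hP] : exists2 g, L2 g & forall eps : R, 0 < eps -> exists n,
      forall s, (n <= s)%N -> \int[Pr]_w ((complex.Im (up s w i 0) - g w) ^+ 2) <= eps.
    apply: Lfun2_complete => [s|eps eps0]; first exact: (Lup s i).2.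
    have [n nP] := up_cauchy i eps0; exists n => s t ns nt.
    apply: le_trans (nP s t ns nt); rewrite /e integral_sqnE//.
    rewrite (_ : \int[Pr]_w _ = \int[Pr]_w (complex.Im (up t w i 0 - up s w i 0) ^+ 2)).
      by rewrite lerDr; apply: Rintegral_ge0 => w _; exact: sqr_ge0.
    by apply: eq_Rintegral => w _; rewrite complex_ImB.
  exists (fun w => g w +i* h w); split=> // eps eps0.
  have eps2 : 0 < eps / 2 by rewrite divr_gt0.
  have [n1 n1P] := gP _ eps2; have [n2 n2P] := hP _ eps2.
  exists (maxn n1 n2) => s; rewrite geq_max => /andP[s1 s2].
  rewrite /e integral_sqnE; last first.
    apply: cLfun2D => //; under eq_fun do rewrite -mulN1r.
    by apply: (@cLfun2Z _ _ _ _ (fun w => g w +i* h w)).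
  rewrite [leRHS]splitr lerD//.
    apply: le_trans (n1P s s1); rewrite le_eqVlt; apply/orP; left; apply/eqP.
    by apply: eq_Rintegral => w _; rewrite complex_ReB.
  apply: le_trans (n2P s s2); rewrite le_eqVlt; apply/orP; left; apply/eqP.
  by apply: eq_Rintegral => w _; rewrite complex_ImB.
exists (fun w => \col_i f i w); split=> [i|i eps eps0].
  by under eq_fun do rewrite mxE; exact: (fP i).1.
have [n nP] := (fP i).2 eps eps0; exists n => s ns; apply: le_trans (nP s ns).
rewrite le_eqVlt; apply/orP; left; apply/eqP.
by apply: eq_Rintegral => w _; rewrite [X in _ - X]mxE.
Qed.

Let up_mean s i : \int[Pr]_w complex.Re (up s w i 0) = \int[Pr]_w complex.Re (up 0%N w i 0) /\
  \int[Pr]_w complex.Im (up s w i 0) = \int[Pr]_w complex.Im (up 0%N w i 0).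
Proof.
have eta0 t : \int[Pr]_w complex.Re (usubmx (eta t w) i 0) = 0 /\
    \int[Pr]_w complex.Im (usubmx (eta t w) i 0) = 0.
  have iN l : L1 (fun w => N t w l 0) by exact: Lfun2_integrable.
  have lin (c : 'I_(r + m) -> R) : \int[Pr]_w (\sum_l c l * N t w l 0) = 0.
    rewrite Rintegral_sum => [|l]; last exact: integrableZ_EFin.
    by rewrite big1// => l _; rewrite RintegralZl// meanN mulr0.
  split.
    rewrite -[RHS](lin (fun l => complex.Re (H (lshift m i) l))).
    apply: eq_Rintegral => w _; rewrite [usubmx _ _ _]mxE [eta _ _ _ _]mxE complex_Re_sum.
    by apply: eq_bigr => l _; rewrite complex_ReM mxE /= mulr0 subr0.
  rewrite -[RHS](lin (fun l => complex.Im (H (lshift m i) l))).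
  apply: eq_Rintegral => w _; rewrite [usubmx _ _ _]mxE [eta _ _ _ _]mxE complex_Im_sum.
  by apply: eq_bigr => l _; rewrite complex_ImM mxE /= mulr0 add0r.
elim: s => [|s [IH1 IH2]]; first by split.
have entry w : up s.+1 w i 0 = up s w i 0 + (a s)%:C * usubmx (eta s w) i 0.
  by rewrite up_rec mxE [X in _ + X]mxE.
have [U1 U2] := Lup s i; have [E1 E2] := Lusub_eta s i.
have i1 := Lfun2_integrable U1; have i2 := Lfun2_integrable U2.
have j1 := Lfun2_integrable E1; have j2 := Lfun2_integrable E2.
split.
  transitivity (\int[Pr]_w (complex.Re (up s w i 0) +
      a s * complex.Re (usubmx (eta s w) i 0))).
    by apply: eq_Rintegral => w _; rewrite entry complex_ReD complex_ReM /= mul0r subr0.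
  rewrite (RintegralD measurableT i1 (integrableZ_EFin (a s) j1)).
  rewrite (RintegralZl (a s) measurableT j1) (eta0 s).1 mulr0 addr0; exact: IH1.
transitivity (\int[Pr]_w (complex.Im (up s w i 0) +
    a s * complex.Im (usubmx (eta s w) i 0))).
  by apply: eq_Rintegral => w _; rewrite entry complex_ImD complex_ImM /= mul0r addr0.
rewrite (RintegralD measurableT i2 (integrableZ_EFin (a s) j2)).
rewrite (RintegralZl (a s) measurableT j2) (eta0 s).2 mulr0 addr0; exact: IH2.
Qed.

(** The mean of [up s] does not depend on s, and by [Rintegral_sqr_le] the squared distance between
    the means is at most the L^2 error, which is arbitrarily small. *)
Let up_limit_mean (L : T -> 'cV[R[i]]_r) i : cLfun2 Pr (fun w => L w i 0) ->
  (forall eps : R, 0 < eps -> exists n, forall s, (n <= s)%N ->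
    e (fun w => up s w i 0 - L w i 0) <= eps) ->
  \int[Pr]_w complex.Re (L w i 0) = \int[Pr]_w complex.Re (up 0%N w i 0) /\
  \int[Pr]_w complex.Im (L w i 0) = \int[Pr]_w complex.Im (up 0%N w i 0).
Proof.
move=> [L1 L2] Lcvg.
have small (c : R) : (forall eps : R, 0 < eps -> c ^+ 2 <= eps) -> c = 0.
  move=> h; apply/eqP; rewrite -sqrf_eq0 eq_le sqr_ge0 andbT.
  by apply/ler_addgt0Pr => eps eps0; rewrite add0r; exact: h.
have diff s : cLfun2 Pr (fun w => up s w i 0 - L w i 0).
  apply: cLfun2D => //; under eq_fun do rewrite -mulN1r.
  exact: (@cLfun2Z _ _ _ _ (fun w => L w i 0)).
have e_Re s : (\int[Pr]_w complex.Re (up 0%N w i 0) - \int[Pr]_w complex.Re (L w i 0)) ^+ 2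
    <= e (fun w => up s w i 0 - L w i 0).
  rewrite -(up_mean s i).1 -RintegralB//; last 2 first.
  - exact: Lfun2_integrable (Lup s i).1.
  - exact: Lfun2_integrable.
  apply: (le_trans (Rintegral_sqr_le (Lfun2B (Lup s i).1 L1))).
  rewrite /e integral_sqnE//.
  rewrite (eq_Rintegral Pr (g := fun w => complex.Re (up s w i 0 - L w i 0) ^+ 2)) => [|w _].
    by rewrite lerDl; apply: Rintegral_ge0 => w _; exact: sqr_ge0.
  by rewrite complex_ReB.
have e_Im s : (\int[Pr]_w complex.Im (up 0%N w i 0) - \int[Pr]_w complex.Im (L w i 0)) ^+ 2
    <= e (fun w => up s w i 0 - L w i 0).
  rewrite -(up_mean s i).2 -RintegralB//; last 2 first.
  - exact: Lfun2_integrable (Lup s i).2.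
  - exact: Lfun2_integrable.
  apply: (le_trans (Rintegral_sqr_le (Lfun2B (Lup s i).2 L2))).
  rewrite /e integral_sqnE//.
  rewrite (eq_Rintegral Pr (g := fun w => complex.Im (up s w i 0 - L w i 0) ^+ 2)) => [|w _].
    by rewrite lerDr; apply: Rintegral_ge0 => w _; exact: sqr_ge0.
  by rewrite complex_ImB.
split; apply/esym/eqP; rewrite -subr_eq0; apply/eqP; apply: small => eps eps0;
  have [n nP] := Lcvg eps eps0.
- exact: le_trans (e_Re n) (nP n (leqnn n)).
- exact: le_trans (e_Im n) (nP n (leqnn n)).
Qed.

Lemma recursion_mean_square_limit (x0 : 'cV[R]_(r + m)) : (forall w, x 0%N w = x0) ->
  exists ybar : T -> 'cV[R[i]]_r,
    [/\ random_cvec ybar,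
        expect_cvec Pr ybar = usubmx (H *m cplx_mx x0),
        ('E_Pr[fun w => (cnorm2 (ybar w) ^+ 2)%R] < +oo)%E &
        cvg_mean_square Pr (fun s w => cplx_mx (x s w))
          (fun w => invmx H *m col_mx (ybar w) rest_limit)].
Proof.
move=> x_init; have [L [LL Lcvg]] := up_limit_exists.
have Llim j : cLfun2 Pr (fun w => (invmx H *m col_mx (L w) rest_limit) j 0).
  apply: cLfun2_mulmx => k; rewrite -[k]fintype.splitK.
  case: (fintype.split k) => k' /=.
    by under eq_fun do rewrite col_mxEu.
  by under eq_fun do rewrite col_mxEd; exact: cLfun2_cst.
exists L; split.
- exact: cLfun2_random_cvec LL.
- apply/matrixP => i j; rewrite ord1 mxE {j}.
  have [ReL ImL] := up_limit_mean (LL i) (Lcvg i).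
  have up0 w : up 0%N w i 0 = usubmx (H *m cplx_mx x0) i 0 by rewrite /up /y x_init.
  have -> : fine 'E_Pr[fun w => (complex.Re (L w i 0))%R]%E =
      complex.Re (usubmx (H *m cplx_mx x0) i 0).
    rewrite unlock -[LHS]/(\int[Pr]_w complex.Re (L w i 0)) ReL.
    rewrite -[RHS](Rintegral_cst_probability Pr).
    by apply: eq_Rintegral => w _; rewrite up0.
  have -> : fine 'E_Pr[fun w => (complex.Im (L w i 0))%R]%E =
      complex.Im (usubmx (H *m cplx_mx x0) i 0).
    rewrite unlock -[LHS]/(\int[Pr]_w complex.Im (L w i 0)) ImL.
    rewrite -[RHS](Rintegral_cst_probability Pr).
    by apply: eq_Rintegral => w _; rewrite up0.
  by case: (usubmx _ i 0).
- by rewrite expectation_cnorm2_sqr// ltry.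
split.
- exact: cLfun2_random_cvec Llim.
- by rewrite expectation_cnorm2_sqr// ltry.
(* The error in Jordan coordinates; [invmx H] carries it back at the cost of a constant factor. *)
pose Z s w : 'cV[R[i]]_(r + m) := col_mx (up s w - L w) (low s w).
have ZE s w : cplx_mx (x s w) - invmx H *m col_mx (L w) rest_limit = invmx H *m Z s w.
  rewrite -[cplx_mx _](mulKmx uH) -/(y s w) -mulmxBr -{1}(vsubmxK (y s w)).
  by rewrite opp_col_mx add_col_mx.
have LZu s i : cLfun2 Pr (fun w => (up s w - L w) i 0).
  under eq_fun do rewrite mxE [X in _ + X]mxE -mulN1r.
  by apply: cLfun2D => //; exact: cLfun2Z.
have LZ s j : cLfun2 Pr (fun w => Z s w j 0).
  rewrite -[j]fintype.splitK; case: (fintype.split j) => k /=.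
    by under eq_fun do rewrite col_mxEu.
  by under eq_fun do rewrite col_mxEd.
have [K K0 KP] := e_mulmx_le (invmx H).
rewrite (_ : (fun s => _) = fun s => (\sum_i e (fun w => (invmx H *m Z s w) i 0))%:E);
  last first.
  apply/funext => s; under eq_fun do rewrite ZE.
  exact: expectation_cnorm2_sqr (fun i => cLfun2_mulmx (invmx H) i (LZ s)).
apply: cvg_EFin; first exact: nearW.
apply/cvgrPdist_le => eps eps0.
(* The r martingale coordinates and the whole lower block contribute at most [delta] each, which
   gives r + 1 shares, multiplied by K. *)
pose delta := eps / (K + 1) / r.+1%:R.
have K1 : 0 < K + 1 by rewrite ltr_wpDl.
have delta0 : 0 < delta by rewrite !divr_gt0.
have /choice[nu nuP] i := Lcvg i delta delta0.
have [nl nlP] := low_cvg delta0.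
exists (maxn (\max_i nu i) nl) => // s /=; rewrite geq_max => /andP[sr sl].
rewrite sub0r normrN ger0_norm; last first.
  by apply: sumr_ge0 => i _; exact: integral_sqn_ge0.
apply: (le_trans (KP _ (LZ s))); rewrite big_split_ord /=.
have Zu : \sum_i e (fun w => Z s w (lshift m i) 0) <= delta *+ r.
  rewrite -[X in _ *+ X]card_ord -sumr_const; apply: ler_sum => i _.
  rewrite (_ : e _ = e (fun w => up s w i 0 - L w i 0)).
    by apply: nuP; apply: leq_trans sr; exact: leq_bigmax.
  by apply: eq_Rintegral => w _; rewrite col_mxEu mxE [X in _ + X]mxE.
have Zl : \sum_i e (fun w => Z s w (rshift r i) 0) <= delta.
  apply: le_trans (nlP s sl); apply: ler_sum => i _; rewrite le_eqVlt; apply/orP; left.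
  by apply/eqP/eq_Rintegral => w _; rewrite col_mxEd.
apply: (@le_trans _ _ (K * (delta *+ r.+1))).
  by rewrite ler_wpM2l// mulrSr lerD.
rewrite -mulr_natr /delta divfK ?pnatr_eq0// mulrA ler_pdivrMr// mulrC.
by rewrite ler_wpM2l ?(ltW eps0)// lerDl.
Qed.

End StochasticRecursion.

Section GainSeries.
Context (R : realType) (a : nat -> R).

Lemma A2_unbounded : A2 a -> forall M : R, exists n, M <= \sum_(0 <= k < n) `|a k|.
Proof.
move=> [a0 adv _] M; apply: contrapT => /forallNP bnd.
have : (\sum_(0 <= s <oo) (a s)%:E <= M%:E)%E.
  apply: lime_le; first by apply: is_cvg_nneseries => n _ _; rewrite lee_fin.
  apply: nearW => n; rewrite sumEFin lee_fin ltW// real_ltNge ?num_real//.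
  by apply/negP => h; apply: (bnd n); under eq_bigr do rewrite ger0_norm//.
by rewrite adv leye_eq.
Qed.

Lemma A2'_unbounded : A2' a -> forall M : R, exists n, M <= \sum_(0 <= k < n) `|a k|.
Proof.
move=> [a0 adv _] M; apply: contrapT => /forallNP bnd.
have : ((- M)%:E <= \sum_(0 <= s <oo) (a s)%:E)%E.
  apply: lime_ge; first by apply: is_cvg_npeseries => n _ _; rewrite lee_fin.
  apply: nearW => n; rewrite sumEFin lee_fin lerNl -sumrN ltW// real_ltNge ?num_real//.
  by apply/negP => h; apply: (bnd n); under eq_bigr do rewrite ler0_norm//.
by rewrite adv leeNy_eq.
Qed.

Lemma sqr_summable_cvg : (\sum_(0 <= s <oo) (a s ^+ 2)%:E < +oo)%E ->
  cvgn (series (fun k => a k ^+ 2)).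
Proof. by apply: nnseries_is_cvg => k; exact: sqr_ge0. Qed.

End GainSeries.

(* The dimension n of the state space is r + m, so m stands for n - r. *)
Theorem theorem3p1 (R : realType) (d : measure_display) (T : measurableType d)
    (Pr : probability T R) (r m : nat)
    (a : nat -> R)
    (Ps : nat -> T -> 'M[R]_(r + m)) (us : nat -> T -> 'cV[R]_(r + m))
    (P : 'M[R]_(r + m)) (u : 'cV[R]_(r + m))
    (H D : 'M[R[i]]_(r + m)) (Dl : 'M[R[i]]_m)
    (x0 : 'cV[R]_(r + m)) (x : nat -> T -> 'cV[R]_(r + m)) :
  (forall s, random_mx (Ps s)) ->
  (forall s, random_mx (us s)) ->
  (forall w, x 0%N w = x0) ->
  (forall s w,
     x s.+1 w = (1 - a s) *: x s w + a s *: (Ps s w *m x s w + us s w)) ->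
  [/\ A1 Pr x Ps us P u, A2 a, A3 P u & rho_max P = 1] \/
  [/\ A1 Pr x Ps us P u, A2' a, A3 P u & rho_min P = 1] ->
  r = alg_mult (cplx_mx P) 1 ->
  H \in unitmx ->
  cplx_mx P = invmx H *m D *m H ->
  jordan_normal_form D ->
  D = block_mx 1%:M 0 0 Dl ->
  exists ybar : T -> 'cV[R[i]]_r,
    [/\ random_cvec ybar,
        expect_cvec Pr ybar = usubmx (H *m cplx_mx x0),
        ('E_Pr[fun w => (cnorm2 (ybar w) ^+ 2)%R] < +oo)%E &
        cvg_mean_square Pr (fun s w => cplx_mx (x s w))
          (fun w => invmx H *m
             col_mx (ybar w)
               (invmx (1%:M - Dl) *m dsubmx (H *m cplx_mx u)))].
Proof.
move=> mPs mus x_init x_rec hyp r_mult uH PHD jD DE.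
(* The two sets of hypotheses are merged: beyond this point they differ only in the value of
   [sg]. *)
have [A1x A3Pu [sg [sgrho [a_sg a_dvg a_sqr]]]] : [/\ A1 Pr x Ps us P u, A3 P u &
    exists sg, (sg = 1 /\ rho_max P = 1 \/ sg = -1 /\ rho_min P = 1) /\
    [/\ forall s, a s = sg * `|a s|,
        forall M : R, exists n, M <= \sum_(0 <= k < n) `|a k| &
        cvgn (series (fun k => a k ^+ 2))]].
  case: hyp => -[A1x A2a A3Pu rho]; split=> //.
    exists 1; split; [by left|split; [|exact: A2_unbounded|]].
      by move=> s; case: A2a => a0 _ _; rewrite mul1r ger0_norm.
    by case: A2a => _ _ /sqr_summable_cvg.
  exists (-1); split; [by right|split; [|exact: A2'_unbounded|]].
    by move=> s; case: A2a => a0 _ _; rewrite mulN1r ler0_norm ?opprK.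
  by case: A2a => _ _ /sqr_summable_cvg.
have [beta beta0 gap] := spectral_gap A3Pu r_mult uH PHD jD DE sgrho.
have HP := jordan_mulmx uH PHD; rewrite DE in HP.
exact: (recursion_mean_square_limit
  (Lfun2_state mPs mus x_init x_rec A1x) (Lfun2_noise mPs mus x_init x_rec A1x)
  (noise_orthogonal_state mPs mus x_init x_rec A1x)
  (noise_centered mPs mus x_init x_rec A1x)
  (noise_second_moment mPs mus x_init x_rec A1x) (noise_rec P u x_rec)
  a_sg a_dvg a_sqr uH HP (usubmx_forcing0 A3Pu uH PHD DE)
  (jordan_rest_unit r_mult uH PHD jD DE) (jordan_rest_upper jD DE)
  beta0 gap x_init).
Qed.
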